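(* Let $k$ be an algebraically closed field of characteristic $p>2$, $G=SL_2$ over $k$, and let $r\in\mathbb{Z}_{>0}$. Then $(T_r(m):\Delta_r(n))\in\{0,1\}$ for all $m,n\in\mathbb{Z}$.
   Context: For $G=SL_2$ with maximal torus $T$, $X(T)=\mathbb{Z}$, the positive root is $2$, $\rho=1$. $F$ is the Frobenius endomorphism, $G_r=\ker F^r$, $G_rT=(F^r)^{-1}(T)$, $B$ and $B^+$ the Borel subgroups containing $T$ with root $-2$ and $2$, $B_r$, $B_r^+$ their $r$-th Frobenius kernels. For $n\in\mathbb{Z}$: $\nabla_r(n)=\mathrm{Ind}_{B_rT}^{G_rT}n$ and $\Delta_r(n)=\mathrm{Ind}_{B_r^+T}^{G_rT}(n-2(p^r-1))$. $T_r(m)$ is the indecomposable tilting (equivalently projective) finite dimensional $G_rT$-module with highest weight $m$; it has a filtration with quotients of the form $\Delta_r(n)$, and $(T_r(m):\Delta_r(n))$ is the number of times $\Delta_r(n)$ occurs. *)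

(* Defs.v *)
From HB Require Import structures.
From mathcomp Require Import all_boot all_order all_algebra.

Set Implicit Arguments.
Unset Strict Implicit.
Unset Printing Implicit Defensive.

Import GRing.Theory.
Local Open Scope ring_scope.

(* Group schemes over k are treated through their functors of points on       *)
(* commutative k-algebras. A closed subgroup scheme of SL_2 is given by its   *)
(* A-points inside 'M[A]_2, with T the diagonal torus, t = diag(t, t^-1), so  *)
(* that the positive root 2 is the one of the upper triangular Borel B^+.     *)

Section SL2.

Variables (k : closedFieldType) (p r : nat).

Definition frob (A : comAlgType k) (g : 'M[A]_2) : 'M[A]_2 :=
  map_mx (fun x => x ^+ p) g.

Definition SL2 (A : comAlgType k) (g : 'M[A]_2) : bool := \det g == 1.

Definition torus (A : comAlgType k) (g : 'M[A]_2) : bool :=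
  SL2 g && is_diag_mx g.

Definition GrT (A : comAlgType k) (g : 'M[A]_2) : bool :=
  SL2 g && torus (iter r (@frob A) g).

(* The subgroups B_r T = B :&: G_r T and B_r^+ T = B^+ :&: G_r T. *)
Definition BrT (A : comAlgType k) (g : 'M[A]_2) : bool :=
  GrT g && is_trig_mx g.

Definition BrpT (A : comAlgType k) (g : 'M[A]_2) : bool :=
  GrT g && is_trig_mx g^T.

(* The character t |-> t ^ n of T, extended to both Borel subgroups; on these *)
(* the two diagonal entries of g are inverse to each other.                   *)
Definition chi (n : int) (A : comAlgType k) (g : 'M[A]_2) : A :=
  match n with
  | Posz j => g ord0 ord0 ^+ j
  | Negz j => g ord_max ord_max ^+ j.+1
  end.

(* Finite dimensional G_r T-modules: a functorial A-linear action of G_r T(A) *)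
(* on the column vectors k^d (x) A = A^d. The value of the action on a matrix *)
(* that is not in G_r T(A) is irrelevant.                                     *)
Record GrTmod := GrTMod {
  dim : nat;
  act : forall A : comAlgType k, 'M[A]_2 -> 'M[A]_dim;
  act1 : forall A : comAlgType k, act (1%:M : 'M[A]_2) = 1%:M;
  actM : forall (A : comAlgType k) (g h : 'M[A]_2),
    GrT g -> GrT h -> act (g *m h) = act g *m act h;
  act_nat : forall (A B : comAlgType k) (u : {lrmorphism A -> B})
      (g : 'M[A]_2),
    GrT g -> act (map_mx u g) = map_mx u (act g)
}.

Definition extmx (A : comAlgType k) m n (X : 'M[k]_(m, n)) : 'M[A]_(m, n) :=
  map_mx (in_alg A) X.

Definition is_hom (M N : GrTmod) (X : 'M[k]_(dim N, dim M)) : Prop :=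
  forall (A : comAlgType k) (g : 'M[A]_2),
    GrT g -> extmx A X *m act M g = act N g *m extmx A X.

Definition isoGrT (M N : GrTmod) : Prop :=
  exists (X : 'M[k]_(dim N, dim M)) (Y : 'M[k]_(dim M, dim N)),
    [/\ is_hom X, is_hom Y, Y *m X = 1%:M & X *m Y = 1%:M].

Definition short_exact (M' M M'' : GrTmod)
    (i : 'M[k]_(dim M, dim M')) (q : 'M[k]_(dim M'', dim M)) : Prop :=
  [/\ is_hom i, is_hom q,
      forall v : 'cV[k]_(dim M'), i *m v = 0 -> v = 0,
      forall w : 'cV[k]_(dim M''), exists v, w = q *m v
    & forall v : 'cV[k]_(dim M), q *m v = 0 <-> exists u, v = i *m u].

Section DirectSum.
Variables M N : GrTmod.

Definition dsum_act (A : comAlgType k) (g : 'M[A]_2) :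
    'M[A]_(dim M + dim N) :=
  block_mx (act M g) 0 0 (act N g).

Fact dsum_act1 (A : comAlgType k) : dsum_act (1%:M : 'M[A]_2) = 1%:M.
Proof. by rewrite /dsum_act !act1 -scalar_mx_block. Qed.

Fact dsum_actM (A : comAlgType k) (g h : 'M[A]_2) :
  GrT g -> GrT h -> dsum_act (g *m h) = dsum_act g *m dsum_act h.
Proof.
move=> Gg Gh; rewrite /dsum_act !actM // mulmx_block.
by rewrite !mul0mx !mulmx0 !addr0 !add0r.
Qed.

Fact dsum_act_nat (A B : comAlgType k) (u : {lrmorphism A -> B})
  (g : 'M[A]_2) : GrT g -> dsum_act (map_mx u g) = map_mx u (dsum_act g).
Proof. by move=> Gg; rewrite /dsum_act !act_nat // map_block_mx !map_mx0. Qed.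

Definition dsum : GrTmod := GrTMod dsum_act1 dsum_actM dsum_act_nat.

End DirectSum.

Definition indecomposable (M : GrTmod) : Prop :=
  (0 < dim M)%N /\
  forall M1 M2 : GrTmod, isoGrT M (dsum M1 M2) -> dim M1 = 0%N \/ dim M2 = 0%N.

Definition is_weight (M : GrTmod) (n : int) : Prop :=
  exists2 v : 'cV[k]_(dim M), v != 0 &
    forall (A : comAlgType k) (t : 'M[A]_2),
      torus t -> act M t *m extmx A v = chi n t *: extmx A v.

(* The order on X(T): n <= m iff m - n is a multiple in N of the root 2. *)
Definition highest_weight (M : GrTmod) (m : int) : Prop :=
  is_weight M m /\
  forall n : int, is_weight M n -> exists j : nat, m - n = j%:Z * 2.

(* Elements of k[G_r T], as natural transformations from G_r T to the affine  *)
(* line; only the values on G_r T(A) matter.                                  *)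
Definition is_regular (f : forall A : comAlgType k, 'M[A]_2 -> A) : Prop :=
  forall (A B : comAlgType k) (u : {lrmorphism A -> B}) (g : 'M[A]_2),
    GrT g -> f B (map_mx u g) = u (f A g).

(* Ind_H^{G_r T} n, the functions f with f (g h) = n(h)^-1 f(g). *)
Definition in_Ind (H : forall A : comAlgType k, 'M[A]_2 -> bool) (n : int)
    (f : forall A : comAlgType k, 'M[A]_2 -> A) : Prop :=
  is_regular f /\
  forall (A : comAlgType k) (g h : 'M[A]_2),
    GrT g -> H A h -> chi n h * f A (g *m h) = f A g.

(* M is isomorphic to Ind_H^{G_r T} n: some basis f of the latter transforms  *)
(* under left translation, (g f)(x) = f (g^-1 x), by the matrices act M g.    *)
(* The inverse of g in SL_2(A) is its adjugate.                               *)
Definition iso_Ind (H : forall A : comAlgType k, 'M[A]_2 -> bool) (n : int)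
    (M : GrTmod) : Prop :=
  exists f : 'I_(dim M) -> forall A : comAlgType k, 'M[A]_2 -> A,
    [/\ forall j, in_Ind H n (f j),
        forall e, in_Ind H n e ->
          exists! c : 'cV[k]_(dim M), forall (A : comAlgType k) (x : 'M[A]_2),
            GrT x -> e A x = \sum_j c j 0 *: f j A x
      & forall (A : comAlgType k) (g x : 'M[A]_2) j, GrT g -> GrT x ->
          f j A (\adj g *m x) = \sum_i act M g i j * f i A x].

Definition iso_nabla (n : int) (M : GrTmod) : Prop := iso_Ind BrT n M.

Definition iso_Delta (n : int) (M : GrTmod) : Prop :=
  iso_Ind BrpT (n - 2 * ((p ^ r)%N%:Z - 1)) M.

(* filtered C s M: M has a finite filtration by submodules whose successive   *)
(* quotients, from top to bottom, are in the classes C n for n in s.          *)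
Inductive filtered (C : int -> GrTmod -> Prop) : seq int -> GrTmod -> Prop :=
| filtered_nil M : dim M = 0%N -> filtered C [::] M
| filtered_cons n s M' M M'' i q :
    @short_exact M' M M'' i q -> filtered C s M' -> C n M'' ->
    filtered C (n :: s) M.

Definition tilting (M : GrTmod) : Prop :=
  (exists s, filtered iso_Delta s M) /\ (exists s, filtered iso_nabla s M).

Definition is_Tr (m : int) (M : GrTmod) : Prop :=
  [/\ tilting M, indecomposable M & highest_weight M m].

(* The value c of (M : Delta_r(n)). It is a relation because the independence *)
(* of the filtration is a theorem, not part of the definition; the Delta_r(n) *)
(* are pairwise non-isomorphic, so counting labels counts the factors.        *)
Definition Delta_mult (M : GrTmod) (n : int) (c : nat) : Prop :=
  exists2 s, filtered iso_Delta s M & c = count_mem n s.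

End SL2.

(* Main.v *)
(* Let q = p^r. The tilting module T is free over U_r^-, so the multiplicity   *)
(* of Delta_r(n) is the dimension of its U_r^- -invariants of weight           *)
(* n - 2(q-1), and every such invariant is the image of a weight vector under  *)
(* the divided power F^(q-1). Averaging over G_r T / T, identified with        *)
(* U_r^- x U_r^+, that is, taking the coefficient of x^(q-1) y^(q-1) in        *)
(*   u^-(y) u^+(x) X u^+(x)^-1 u^-(y)^-1,                                      *)
(* turns a T-equivariant map X into a G_r T-equivariant one. Induction along   *)
(* the nabla_r-filtration shows that id_T is such an average. Write it as a    *)
(* sum of averages of T-equivariant maps of rank one; the endomorphism ring of *)
(* the indecomposable T is local, so one of these averages is invertible. But  *)
(* the average of a map of rank one sends all U_r^- -invariants of a given     *)
(* weight to a single line.                                                    *)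

(* The argument is a count of invariants. Each factor Delta_r(n) contributes one U_r^- -invariant of
   weight n - 2(q-1) to T ([Delta_filtered]), so it suffices that any two such invariants are
   proportional. The averaging is done by hand. A point x of a root subgroup of G_r satisfies x^q =
   0, so by Yoneda whatever depends naturally on x is a polynomial of degree less than q with
   coefficients over k ([nil_expand]), and its coefficient at x^(q-1) is a translation invariant
   integral. Integrating u(x) X u(-x) makes X equivariant under that root subgroup ([tr_ub_hom]).
   Integrating first over U_r^+ and then over U_r^- keeps the first equivariance ([tr_opp_hom]),
   because the weight 2(q-1) acquired in the first step is the Jacobian of the substitution x ->
   x/(1+sx). Hence [Tr_hom]. In [trace_surj], the Delta_r-filtration of the target makes every
   invariant an F^(q-1)-image, and the nabla_r-filtration of the source reduces a homomorphism to
   its value on one generating invariant; so id_T = Tr th with th equivariant under T. A weight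
   basis of T decomposes th into maps of rank at most one, and by [sum_unit], which rests on
   Fitting's lemma ([End_local]), the average G of one of them is invertible. By [tr_line], G maps
   all invariants of a fixed weight into one line. T-semisimplicity is established on the way:
   [cocycle_coboundary] gives the vanishing of extensions between characters of T, and [weight_lift]
   uses it to lift weight vectors. *)
Require Import Defs.
From HB Require Import structures.
From mathcomp Require Import all_boot all_order all_algebra.
From mathcomp Require Import ring zify.

Set Implicit Arguments.
Unset Strict Implicit.
Unset Printing Implicit Defensive.

Import GRing.Theory.
Local Open Scope ring_scope.

Local Notation dim := Defs.dim.

(** * Truncated polynomials and radicals *)

(* A[X] / (h) as an algebra over k; {poly %/ h} is only one over A. *)
Definition adjoin (k : closedFieldType) (A : comAlgType k) (h : {poly A}) : Type :=
  {poly %/ h}.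

Section Adjoin.

Variables (k : closedFieldType) (A : comAlgType k) (h : {poly A}).

HB.instance Definition _ := GRing.ComNzRing.copy (adjoin h) {poly %/ h}.

Definition adjoin_scale (c : k) (z : adjoin h) : adjoin h :=
  (c%:A : A) *: (z : {poly %/ h}).

Fact adjoin_scaleA a b z :
  adjoin_scale a (adjoin_scale b z) = adjoin_scale (a * b) z.
Proof. by rewrite /adjoin_scale scalerA -(rmorphM (in_alg A)). Qed.

Fact adjoin_scale1 : left_id 1 adjoin_scale.
Proof. by move=> z; rewrite /adjoin_scale !scale1r. Qed.

Fact adjoin_scaleDr : right_distributive adjoin_scale +%R.
Proof. by move=> a y z; rewrite /adjoin_scale scalerDr. Qed.

Fact adjoin_scaleDl z : {morph adjoin_scale^~ z : a b / a + b}.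
Proof. by move=> a b; rewrite /adjoin_scale !scalerDl. Qed.

HB.instance Definition _ := GRing.Zmodule_isLmodule.Build k (adjoin h)
  adjoin_scaleA adjoin_scale1 adjoin_scaleDr adjoin_scaleDl.

Fact adjoin_scaleAl (a : k) (y z : adjoin h) : a *: (y * z) = a *: y * z.
Proof. exact: (@scalerAl A {poly %/ h}). Qed.

HB.instance Definition _ :=
  GRing.Lmodule_isLalgebra.Build k (adjoin h) adjoin_scaleAl.

Fact adjoin_scaleAr (a : k) (y z : adjoin h) : a *: (y * z) = y * (a *: z).
Proof. exact: (@scalerAr A {poly %/ h}). Qed.

HB.instance Definition _ :=
  GRing.Lalgebra_isAlgebra.Build k (adjoin h) adjoin_scaleAr.

Definition adjC (a : A) : adjoin h := qpolyC h a.
Definition adjX : adjoin h := in_qpoly h 'X.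
Definition adjcoef (i : nat) (z : adjoin h) : A := (val (z : {poly %/ h}))`_i.

Fact adjC_zmod_morphism : zmod_morphism adjC.
Proof. exact: qpolyC_is_zmod_morphism. Qed.
Fact adjC_monoid_morphism : monoid_morphism adjC.
Proof. exact: qpolyC_is_monoid_morphism. Qed.
Fact adjC_scalable : scalable adjC.
Proof.
move=> c a; apply/val_inj.
change ((c *: a)%:P = (c%:A : A) *: (a%:P : {poly A})).
by rewrite -(mulr_algl c a) polyCM mul_polyC.
Qed.

HB.instance Definition _ :=
  GRing.isZmodMorphism.Build A (adjoin h) adjC adjC_zmod_morphism.
HB.instance Definition _ :=
  GRing.isMonoidMorphism.Build A (adjoin h) adjC adjC_monoid_morphism.
HB.instance Definition _ :=
  GRing.isScalable.Build k A (adjoin h) *:%R adjC adjC_scalable.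

Fact adjcoef_zmod_morphism i : zmod_morphism (adjcoef i).
Proof. by move=> y z; rewrite /adjcoef /= coefB. Qed.
HB.instance Definition _ i :=
  GRing.isZmodMorphism.Build (adjoin h) A (adjcoef i) (adjcoef_zmod_morphism i).

Lemma adjcoefCM i a z : adjcoef i (adjC a * z) = a * adjcoef i z.
Proof.
have -> : adjC a * z = a *: (z : {poly %/ h}).
  apply/val_inj => /=.
  rewrite mul_polyC Pdiv.RingMonic.rmodpZ ?monic_mk_monic //.
  by rewrite Pdiv.CommonRing.rmodp_small ?size_mk_monic.
by rewrite /adjcoef /= coefZ.
Qed.

Lemma adjC_inj : injective adjC.
Proof. by move=> a b /(congr1 (adjcoef 0)); rewrite /adjcoef /= !coefC. Qed.

(** The quotient [{poly %/ h}] divides by [mk_monic h], which is h only for h monic and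
    nonconstant. *)
Lemma in_qpoly_modulus : (1 < size h)%N -> h \is monic -> in_qpoly h h = 0.
Proof.
move=> h1 hm; apply/val_inj => /=.
by rewrite /mk_monic h1 hm /= Pdiv.RingMonic.rmodpp.
Qed.

End Adjoin.

Arguments adjC {k A} h a.
Arguments adjX {k A} h.

Section Truncated.

Variables (k : closedFieldType) (A : comAlgType k) (q : nat).
Hypothesis q_gt0 : (0 < q)%N.

Definition trunc : comAlgType k := adjoin ('X^q : {poly A}).
Notation XX := (adjX ('X^q : {poly A})).
Notation CC := (adjC ('X^q : {poly A})).

Lemma trunc_nil : XX ^+ q = 0 :> trunc.
Proof.
rewrite -[LHS](rmorphXn (in_qpoly ('X^q : {poly A}))) /=.
apply: in_qpoly_modulus; last exact: monicXn.
by rewrite size_polyXn ltnS.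
Qed.

Lemma size_truncE : size (mk_monic ('X^q : {poly A})) = q.+1.
Proof. by rewrite mk_monic_Xn size_polyXn prednK. Qed.

Lemma trunc_coefX i j : (i < q)%N -> adjcoef j (XX ^+ i : trunc) = (i == j)%:R.
Proof.
move=> iq; rewrite -[_ ^+ i](rmorphXn (in_qpoly ('X^q : {poly A}))) /=.
rewrite /adjcoef /= Pdiv.CommonRing.rmodp_small ?coefXn 1?eq_sym //.
by rewrite size_polyXn size_truncE ltnS.
Qed.

Lemma trunc_coefX_ge i j : (q <= j)%N -> adjcoef j (i : trunc) = 0.
Proof.
move=> qj; rewrite /adjcoef /= nth_default //.
by apply: leq_trans qj; rewrite -ltnS -size_truncE; apply: size_mk_monic.
Qed.

Lemma trunc_expand (z : trunc) : z = \sum_(i < q) XX ^+ i * CC (adjcoef i z).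
Proof.
apply/val_inj/polyP => j; rewrite [RHS](_ :
  _ = adjcoef j (\sum_(i < q) XX ^+ i * CC (adjcoef i z) : trunc)) //.
rewrite -[LHS]/(adjcoef j z) raddf_sum /=.
under eq_bigr => i _ do rewrite mulrC adjcoefCM trunc_coefX //.
have [jq|qj] := ltnP j q.
  rewrite (bigD1 (Ordinal jq)) //= eqxx mulr1 big1 ?addr0 // => i /negP ij.
  by case: eqP => [e|_]; rewrite ?mulr0 //; case: ij; apply/eqP/val_inj.
rewrite trunc_coefX_ge // big1 // => i _.
by rewrite ltn_eqF ?mulr0 // (leq_trans _ qj).
Qed.

End Truncated.

Section TruncEval.

Variables (k : closedFieldType) (q : nat) (A : comAlgType k) (x : A).
Hypotheses (q_gt0 : (0 < q)%N) (xq : x ^+ q = 0).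

(** The universal property: [trunc k^o q] is the coordinate ring of the scheme x^q = 0, and its
    points in A are the evaluations at such x. *)
Definition trunc_eval (z : trunc k^o q) : A :=
  (map_poly (in_alg A) (val (z : {poly %/ 'X^q}))).[x].

Lemma horner_in_qpoly (f : {poly k^o}) :
  (map_poly (in_alg A) (val (in_qpoly 'X^q f))).[x] = (map_poly (in_alg A) f).[x].
Proof.
rewrite [f in RHS](Pdiv.RingMonic.rdivp_eq (monic_mk_monic ('X^q))).
rewrite rmorphD rmorphM /= hornerD hornerM mk_monic_Xn prednK // map_polyXn.
by rewrite hornerXn xq mulr0 add0r.
Qed.

Fact trunc_eval_zmod_morphism : zmod_morphism trunc_eval.
Proof.
move=> y z; rewrite /trunc_eval -hornerN -hornerD.
by rewrite -(rmorphB (map_poly (in_alg A))).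
Qed.
Fact trunc_eval_monoid_morphism : monoid_morphism trunc_eval.
Proof.
split=> [|y z].
  by rewrite /trunc_eval (_ : val _ = 1) // rmorph1 hornerC.
rewrite /trunc_eval -hornerM -(rmorphM (map_poly (in_alg A))).
exact: horner_in_qpoly.
Qed.
Fact trunc_eval_scalable : scalable trunc_eval.
Proof.
move=> c z; rewrite /trunc_eval.
rewrite (_ : val _ = (c%:A : k^o) *: val (z : {poly %/ 'X^q})) //.
rewrite /= linearZ /= hornerZ.
by rewrite -scalerAl mul1r; congr (_ *: _); apply: mulr1.
Qed.

HB.instance Definition _ :=
  GRing.isZmodMorphism.Build (trunc k^o q) A trunc_eval trunc_eval_zmod_morphism.
HB.instance Definition _ :=
  GRing.isMonoidMorphism.Build (trunc k^o q) A trunc_eval trunc_eval_monoid_morphism.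
HB.instance Definition _ :=
  GRing.isScalable.Build k (trunc k^o q) A *:%R trunc_eval trunc_eval_scalable.

Definition trunc_ev : {lrmorphism trunc k^o q -> A} := trunc_eval.

Lemma trunc_evX : trunc_eval (adjX _) = x.
Proof. by rewrite /trunc_eval horner_in_qpoly map_polyX hornerX. Qed.

Lemma trunc_evC c : trunc_eval (adjC _ c) = c%:A.
Proof. by rewrite /trunc_eval map_polyC hornerC. Qed.

Lemma trunc_evE z : trunc_ev z = \sum_(i < q) adjcoef i z *: x ^+ i.
Proof.
rewrite [in LHS](trunc_expand q_gt0 z) rmorph_sum /=; apply: eq_bigr => i _.
by rewrite rmorphM rmorphXn /= trunc_evX trunc_evC mulr_algr.
Qed.

End TruncEval.

Section Radical.

Variables (k : closedFieldType) (A : comAlgType k) (p : nat) (a : A).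
Hypothesis p_gt1 : (1 < p)%N.

(** An extension containing A in which a has a p-th root; [cocycle_coboundary] uses it to see that T
    has no nonzero homomorphism to the additive group. *)
Definition radical : comAlgType k := adjoin ('X^p - a%:P : {poly A}).
Definition radX : radical := adjX _.
Definition radC : {lrmorphism A -> radical} := adjC _.

Lemma radXp : radX ^+ p = radC a.
Proof.
have p_gt0 := ltnW p_gt1.
have sm : (1 < size ('X^p - a%:P : {poly A})%R)%N by rewrite size_XnsubC.
have := in_qpoly_modulus sm (monicXnsubC a p_gt0).
rewrite rmorphB rmorphXn /= => /eqP; rewrite subr_eq0 => /eqP h.
apply: etrans h _; apply/val_inj.
apply: (@Pdiv.CommonRing.rmodp_small _ a%:P).
apply: leq_ltn_trans (size_mk_monic_gt1 _); exact: size_polyC_leq1.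
Qed.

Lemma radC_inj : injective radC.
Proof. exact: adjC_inj. Qed.

End Radical.

Section TruncPoly.

Variables (k : closedFieldType) (A : comAlgType k) (q : nat).
Hypothesis q_gt0 : (0 < q)%N.
Local Notation C := (adjC ('X^q : {poly A})).
Local Notation X := (adjX ('X^q : {poly A})).

Lemma adjcoef_in_qpoly (f : {poly A}) j : (j < q)%N ->
  adjcoef j (in_qpoly 'X^q f : trunc A q) = f`_j.
Proof.
have := Pdiv.RingMonic.rdivp_eq (monic_mk_monic ('X^q : {poly A})) f.
set d := Pdiv.CommonRing.rdivp _ _; rewrite [X in _ * X]mk_monic_Xn prednK // => e jq.
by rewrite [in RHS]e coefD coefMXn jq add0r.
Qed.

Lemma adjC_in_qpoly a : C a = in_qpoly 'X^q a%:P.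
Proof.
apply/val_inj/esym/(@Pdiv.CommonRing.rmodp_small _ a%:P).
by apply: leq_ltn_trans (size_mk_monic_gt1 _); apply: size_polyC_leq1.
Qed.

(** Translation invariance of the integral: (s + X)^i is monic of degree i < q, so nothing is
    reduced modulo X^q. *)
Lemma coef_shift s i : (i < q)%N ->
  adjcoef q.-1 ((C s + X) ^+ i : trunc A q) = (i == q.-1)%:R.
Proof.
move=> iq; rewrite adjC_in_qpoly -[X in X ^+ i](rmorphD (in_qpoly 'X^q)).
rewrite -[_ ^+ i](rmorphXn (in_qpoly 'X^q)) adjcoef_in_qpoly ?prednK //.
rewrite addrC -[s%:P]opprK -polyCN; case: eqP => [->|ne].
  have := lead_coefE (('X - (- s)%:P) ^+ q.-1).
  by rewrite (monicP (monic_exp _ (monicXsubC _))) size_exp_XsubC => <-.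
rewrite nth_default // size_exp_XsubC; move/eqP: ne iq.
by case: q q_gt0 => // n _ /=; rewrite ltnS leq_eqVlt => /negPf->.
Qed.

(* The Jacobian of the action of a unipotent element on the opposite cell. *)
Lemma coef_mobius s c' (i : nat) : (i < q)%N ->
    (1 + C s * X) ^+ q = 1 :> trunc A q ->
    (1 + C s * X) * c' = 1 :> trunc A q ->
  adjcoef q.-1 ((1 + C s * X) ^+ (q.-1 + q.-1) * (X * c') ^+ i : trunc A q)
  = (i == q.-1)%:R.
Proof.
move=> iq c1 cc'.
have -> : (1 + C s * X) ^+ (q.-1 + q.-1) * (X * c') ^+ i =
    (1 + C s * X) ^+ (q.-1 + q.-1 - i) * X ^+ i :> trunc A q.
  have le : (i <= q.-1 + q.-1)%N.
    by rewrite (leq_trans _ (leq_addr _ _)) // -ltnS prednK.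
  rewrite -{1}(subnK le) exprD -mulrA exprMn [_ ^+ i * (_ * _)]mulrCA.
  by rewrite -exprMn cc' expr1n mulr1.
have cE n : (1 + C s * X) ^+ n * X ^+ i = in_qpoly 'X^q ((1 + s%:P * 'X) ^+ n * 'X^i) :> trunc
  A q.
  rewrite (rmorphM (in_qpoly 'X^q)) !(rmorphXn (in_qpoly 'X^q)).
  by rewrite (rmorphD (in_qpoly _)) rmorph1 (rmorphM (in_qpoly _)) adjC_in_qpoly.
case: eqP => [i_eq|ne].
  rewrite cE adjcoef_in_qpoly ?prednK // coefMXn i_eq ltnn subnn addnK.
  by rewrite -horner_coef0 horner_exp !hornerE expr1n.
(* Here n = q - 2 - i. Since (1 + sX)^q = 1, the exponent 2(q-1) - i = q + n drops to n, leaving a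
   polynomial of degree at most n + i = q - 2. *)
have [n nE] : exists n, q.-1 = (i + n).+1.
  have iq1 : (i < q.-1)%N.
    by move/eqP: ne iq; case: q q_gt0 => // n _ /=; rewrite ltnS leq_eqVlt => /negPf->.
  by exists (q.-1 - i.+1)%N; rewrite -addSn subnKC.
have -> : (q.-1 + q.-1 - i = q + n)%N.
  move: q_gt0 nE; clear; lia.
rewrite exprD c1 mul1r cE adjcoef_in_qpoly ?prednK // nth_default //.
apply: leq_trans (size_polyMleq _ _) _; rewrite size_polyXn addnS /= nE.
apply: (@leq_trans (n.+1 + i)); last by rewrite addnC addnS.
rewrite leq_add2r; apply: leq_trans (size_poly_exp_leq _ _) _.
rewrite ltnS -[leqRHS]mul1n leq_mul2r -[(size _).-1]subn1 leq_subLR; apply/orP; right.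
apply: leq_trans (size_polyD _ _) _.
rewrite geq_max size_polyC oner_eq0 /=; apply: leq_trans (size_polyMleq _ _) _.
by rewrite size_polyX addn2 /= size_polyC; case: eqP.
Qed.


End TruncPoly.

Lemma adjCN (k : closedFieldType) (A : comAlgType k) (h : {poly A}) a :
  adjC h (- a) = - adjC h a.
Proof. exact: rmorphN. Qed.

Lemma scale_adjC (k : closedFieldType) (A : comAlgType k) (h : {poly A}) c (z : adjoin h) :
  c *: z = adjC h c%:A * z.
Proof. by rewrite (rmorph_alg (adjC h : {lrmorphism A -> adjoin h})) mulr_algl. Qed.

Section Scalars.

Variables (k : closedFieldType) (A : comAlgType k).

(** The structure map of A with source [k^o], so that it is a morphism of k-algebras to which
    naturality applies. *)
Definition scalars (c : k^o) : A := c%:A.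

Fact scalars_zmod_morphism : zmod_morphism scalars.
Proof. exact: (rmorphB (in_alg A)). Qed.
Fact scalars_monoid_morphism : monoid_morphism scalars.
Proof. by split; [apply: (rmorph1 (in_alg A)) | apply: (rmorphM (in_alg A))]. Qed.
Fact scalars_scalable : scalable scalars.
Proof. by move=> c d; rewrite /scalars scalerA. Qed.

HB.instance Definition _ :=
  GRing.isZmodMorphism.Build k^o A scalars scalars_zmod_morphism.
HB.instance Definition _ :=
  GRing.isMonoidMorphism.Build k^o A scalars scalars_monoid_morphism.
HB.instance Definition _ :=
  GRing.isScalable.Build k k^o A *:%R scalars scalars_scalable.

End Scalars.

Global Opaque adjC adjX adjcoef trunc_eval.

(** * Points of SL_2 and of its subgroups *)

Section Mx2.

Variable R : comNzRingType.

Definition mx2 (a b c d : R) : 'M[R]_2 :=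
  \matrix_(i < 2, j < 2)
    if i == 0 then (if j == 0 then a else b) else (if j == 0 then c else d).

Lemma mx2_eta (g : 'M[R]_2) :
  g = mx2 (g ord0 ord0) (g ord0 ord_max) (g ord_max ord0) (g ord_max ord_max).
Proof.
apply/matrixP => -[[|[|//]] i2] [[|[|//]] j2]; rewrite mxE /=;
  by congr (g _ _); apply/val_inj.
Qed.

Lemma mx2_ind (P : 'M[R]_2 -> Prop) : (forall a b c d, P (mx2 a b c d)) -> forall g, P g.
Proof. by move=> h g; rewrite (mx2_eta g). Qed.

Lemma mx2M a b c d a' b' c' d' :
  mx2 a b c d *m mx2 a' b' c' d' =
  mx2 (a * a' + b * c') (a * b' + b * d') (c * a' + d * c') (c * b' + d * d').
Proof.
by apply/matrixP => i j; rewrite !mxE !big_ord_recl big_ord0 !mxE /= addr0;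
  case: (i == 0); case: (j == 0).
Qed.

Lemma mx2_1 : mx2 1 0 0 1 = 1%:M.
Proof.
by apply/matrixP => -[[|[|//]] i2] [[|[|//]] j2]; rewrite !mxE.
Qed.

Lemma det_mx2 a b c d : \det (mx2 a b c d) = a * d - b * c.
Proof.
rewrite (expand_det_row _ ord0) !big_ord_recl big_ord0 /cofactor !det_mx11.
by rewrite !mxE /= expr0 expr1 !mulN1r mul1r mulrN addr0.
Qed.

Lemma adj_mx2 a b c d : \adj (mx2 a b c d) = mx2 d (- b) (- c) a.
Proof.
apply/matrixP => -[[|[|//]] i2] [[|[|//]] j2];
  by rewrite !mxE /cofactor det_mx11 !mxE /= ?expr0 ?expr1 ?mul1r ?mulN1r
     // ?sqrrN ?expr1n ?mul1r.
Qed.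

Lemma diag_mx2 a b c d : is_diag_mx (mx2 a b c d) = (b == 0) && (c == 0).
Proof.
apply/is_diag_mxP/andP => [h|[/eqP-> /eqP->]].
  have := h 0 1 isT; have := h 1 0 isT; rewrite !mxE /= => -> ->.
  by rewrite !eqxx.
by move=> [[|[|//]] i2] [[|[|//]] j2] //; rewrite mxE.
Qed.

Lemma trigT_mx2 a b c d : is_trig_mx (mx2 a b c d)^T = (c == 0).
Proof.
apply/is_trig_mxP/eqP => [h|->].
  by have := h 0 1 isT; rewrite !mxE.
by move=> [[|[|//]] i2] [[|[|//]] j2] //; rewrite !mxE.
Qed.

Lemma trig_mx2 a b c d : is_trig_mx (mx2 a b c d) = (b == 0).
Proof.
apply/is_trig_mxP/eqP => [h|->].
  by have := h 0 1 isT; rewrite !mxE.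
by move=> [[|[|//]] i2] [[|[|//]] j2] //; rewrite !mxE.
Qed.

Definition uu x := mx2 1 x 0 1.
Definition ul x := mx2 1 0 x 1.
(** A point of T carries the inverse a' of a as a separate argument, as there is no inversion on a
    general algebra. *)
Definition hh a a' := mx2 a 0 0 a'.

End Mx2.

Lemma map_mx2 (R S : comNzRingType) (f : {rmorphism R -> S}) a b c d :
  map_mx f (mx2 a b c d) = mx2 (f a) (f b) (f c) (f d).
Proof. by apply/matrixP => i j; rewrite !mxE; do 2 case: ifP. Qed.

Section Group.

Variables (k : closedFieldType) (p r : nat).
Hypothesis p_char : p \in [pchar k].

Local Notation q := (p ^ r)%N.

Lemma q_gt0 : (0 < q)%N.
Proof. by rewrite expn_gt0 prime_gt0 ?(pcharf_prime p_char). Qed.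

Lemma alg_pchar (A : comAlgType k) : p \in [pchar A].
Proof. exact: (rmorph_pchar (in_alg A)). Qed.

Lemma alg_pcharq (A : comAlgType k) : [pchar A].-nat q.
Proof. by rewrite pnatX (pnatE _ (pcharf_prime p_char)) alg_pchar. Qed.

Lemma frobD (A : comAlgType k) (x y : A) : (x + y) ^+ q = x ^+ q + y ^+ q.
Proof. exact: exprDn_pchar (alg_pcharq A). Qed.

Lemma frobN (A : comAlgType k) (x : A) : (- x) ^+ q = - x ^+ q.
Proof. exact: exprNn_pchar (alg_pcharq A). Qed.

Lemma nil0 (A : comAlgType k) : (0 : A) ^+ q = 0.
Proof. by rewrite expr0n eqn0Ngt q_gt0. Qed.

Lemma nilD (A : comAlgType k) (x y : A) : x ^+ q = 0 -> y ^+ q = 0 -> (x + y) ^+ q = 0.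
Proof. by move=> hx hy; rewrite frobD hx hy addr0. Qed.

Lemma nilN (A : comAlgType k) (x : A) : x ^+ q = 0 -> (- x) ^+ q = 0.
Proof. by move=> hx; rewrite frobN hx oppr0. Qed.

Lemma nilM (A : comAlgType k) (x y : A) : x ^+ q = 0 -> (y * x) ^+ q = 0.
Proof. by move=> hx; rewrite exprMn hx mulr0. Qed.

Lemma iter_frob (A : comAlgType k) a b c d :
  iter r (@frob k p A) (mx2 a b c d) = mx2 (a ^+ q) (b ^+ q) (c ^+ q) (d ^+ q).
Proof.
elim: r => [|n IH]; first by rewrite !expr1.
rewrite iterS IH; apply/matrixP => i j; rewrite !mxE expnSr !exprM.
by do 2 case: ifP.
Qed.

(** Once b^q = 0, a^q d^q = (1 + bc)^q = 1, so the Frobenius twist has determinant 1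
    automatically. *)
Lemma GrT_mx2 (A : comAlgType k) (a b c d : A) :
  GrT p r (mx2 a b c d) = [&& a * d - b * c == 1, b ^+ q == 0 & c ^+ q == 0].
Proof.
rewrite /GrT /torus /SL2 iter_frob !det_mx2 diag_mx2.
case: (a * d - b * c =P 1) => //= e; apply: andb_idl => /andP[/eqP bq /eqP cq].
rewrite bq mul0r subr0 -exprMn -[a * d](subrK (b * c)) e frobD expr1n.
by rewrite exprMn bq mul0r addr0.
Qed.

End Group.

Section Points.

Variables (k : closedFieldType) (p r : nat).
Hypothesis p_char : p \in [pchar k].

Local Notation q := (p ^ r)%N.
Local Notation GrT := (@GrT k p r _).

Section Elements.

Variable A : comAlgType k.
Implicit Types (x y s a : A) (g h t : 'M[A]_2).

Lemma GrT_uu x : x ^+ q = 0 -> GrT (uu x).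
Proof. by move=> hx; rewrite GrT_mx2 // hx nil0 // mul1r mulr0 subr0 !eqxx. Qed.

Lemma GrT_ul x : x ^+ q = 0 -> GrT (ul x).
Proof. by move=> hx; rewrite GrT_mx2 // hx nil0 // mul1r mul0r subr0 !eqxx. Qed.

Lemma GrT_hh a a' : a * a' = 1 -> GrT (hh a a').
Proof. by move=> h; rewrite GrT_mx2 // nil0 // h mul0r subr0 !eqxx. Qed.

Lemma GrTM g h : GrT g -> GrT h -> GrT (g *m h).
Proof.
elim/mx2_ind: g => a b c d; elim/mx2_ind: h => a' b' c' d'.
rewrite mx2M !GrT_mx2 // => /and3P[/eqP e /eqP bq /eqP cq].
move=> /and3P[/eqP e' /eqP b'q /eqP c'q].
rewrite !frobD // !exprMn bq cq b'q c'q !(mul0r, mulr0) addr0 eqxx !andbT.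
apply/eqP; transitivity ((a * d - b * c) * (a' * d' - b' * c')); first by ring.
by rewrite e e' mulr1.
Qed.

Lemma GrT_adj g : GrT g -> GrT (\adj g).
Proof.
elim/mx2_ind: g => a b c d; rewrite adj_mx2 !GrT_mx2 // => /and3P[/eqP e /eqP bq /eqP cq].
by rewrite !frobN // bq cq oppr0 -e mulrNN [d * a]mulrC !eqxx.
Qed.

Lemma uuD x y : uu x *m uu y = uu (x + y).
Proof. by rewrite mx2M; congr mx2; ring. Qed.
Lemma ulD x y : ul x *m ul y = ul (x + y).
Proof. by rewrite mx2M; congr mx2; ring. Qed.
Lemma uu0 : uu (0 : A) = 1%:M. Proof. exact: mx2_1. Qed.
Lemma ul0 : ul (0 : A) = 1%:M. Proof. exact: mx2_1. Qed.
Lemma hhM a a' b b' : hh a a' *m hh b b' = hh (a * b) (a' * b') :> 'M[A]_2.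
Proof. by rewrite mx2M; congr mx2; ring. Qed.
Lemma hh1 : hh (1 : A) 1 = 1%:M. Proof. exact: mx2_1. Qed.

Lemma adj_uu x : \adj (uu x) = uu (- x).
Proof. by rewrite adj_mx2 oppr0. Qed.
Lemma adj_ul x : \adj (ul x) = ul (- x).
Proof. by rewrite adj_mx2 oppr0. Qed.
Lemma adj_hh a a' : \adj (hh a a') = hh a' a.
Proof. by rewrite adj_mx2 oppr0. Qed.

Lemma hh_uu a a' x : a * a' = 1 -> hh a a' *m uu x = uu (a ^+ 2 * x) *m hh a a'.
Proof. by move=> h; rewrite !mx2M; congr mx2; ring: h. Qed.

Lemma hh_ul a a' x : a * a' = 1 -> hh a a' *m ul x = ul (a' ^+ 2 * x) *m hh a a'.
Proof. by move=> h; rewrite !mx2M; congr mx2; ring: h. Qed.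

(** Passage from the cell U^+ U^- to U^- T U^+; on Frobenius kernels 1 + sy is always a unit, by
    [frob_unit] and [frob_inv]. *)
Lemma uu_ul s y c' : (1 + s * y) * c' = 1 ->
  uu s *m ul y = ul (y * c') *m hh (1 + s * y) c' *m uu (s * c').
Proof.
move=> h; have h' : s * y * c' = 1 - c' by rewrite -h; ring.
by rewrite !mx2M; congr mx2; ring: h'.
Qed.

Lemma frob_unit s y : s ^+ q = 0 -> (1 + s * y) ^+ q = 1.
Proof. by move=> hs; rewrite frobD // expr1n exprMn hs mul0r addr0. Qed.

Lemma frob_inv a : a ^+ q = 1 -> a * a ^+ q.-1 = 1.
Proof. by rewrite -exprS prednK ?(q_gt0 r p_char). Qed.

(** The big cell is the whole group: (ad)^q = (1 + bc)^q = 1 makes a a unit with inverse d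
    (ad)^(q-1), and b, c are then eliminated. *)
Lemma GrT_decomp g : GrT g -> exists x y a a',
  [/\ x ^+ q = 0, y ^+ q = 0, a * a' = 1 & g = ul y *m hh a a' *m uu x].
Proof.
elim/mx2_ind: g => a b c d; rewrite GrT_mx2 // => /and3P[/eqP e /eqP bq /eqP cq].
have ad1 : (a * d) ^+ q = 1.
  by rewrite -[a * d](subrK (b * c)) e frob_unit.
pose a' := d * (a * d) ^+ q.-1.
have aa' : a * a' = 1 by rewrite /a' mulrA frob_inv.
clearbody a'; exists (a' * b), (a' * c), a, a'; split=> //; try exact: nilM.
have e' : b * c = a * d - 1 by rewrite -e; ring.
by rewrite !mx2M; congr mx2; ring: aa' e'.
Qed.

End Elements.

Definition pw (A : comAlgType k) (a a' : A) (n : int) : A :=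
  match n with Posz j => a ^+ j | Negz j => a' ^+ j.+1 end.

Lemma chi_mx2 (A : comAlgType k) n (a b c d : A) : chi n (mx2 a b c d) = pw a d n.
Proof. by case: n => j; rewrite /chi mxE. Qed.

Lemma map_pw (A B : comAlgType k) (u : {rmorphism A -> B}) a a' n :
  u (pw a a' n) = pw (u a) (u a') n.
Proof. by case: n => j; rewrite /= rmorphXn. Qed.

Section Power.

Variables (A : comAlgType k) (a a' : A).
Hypothesis aa' : a * a' = 1.

Lemma pwS n : pw a a' (n + 1) = a * pw a a' n.
Proof.
case: n => [j|[|j]]; first by rewrite -PoszD addn1 /pw /= exprS.
  by rewrite /pw /= expr1 aa'.
have -> : Negz j.+1 + 1 = Negz j by rewrite !NegzE -[j.+2]addn1 PoszD opprD addrNK.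
by rewrite /pw [in RHS]exprS mulrA aa' mul1r.
Qed.

Lemma pwB n : pw a a' (n - 1) = a' * pw a a' n.
Proof. by rewrite -[n in RHS](subrK 1) pwS mulrA [a' * a]mulrC aa' mul1r. Qed.

Lemma pwD m n : pw a a' (m + n) = pw a a' m * pw a a' n.
Proof.
elim/int_rect: m => [|m IH|m IH]; first by rewrite add0r /= mul1r.
  by rewrite -addn1 PoszD addrAC !pwS IH mulrA.
by rewrite -addn1 PoszD opprD addrAC !pwB IH mulrA.
Qed.

Lemma pwK n : pw a a' n * pw a a' (- n) = 1.
Proof. by rewrite -pwD subrr. Qed.

Lemma pwMn n j : pw a a' (n *+ j) = pw a a' n ^+ j.
Proof. by elim: j => // j IH; rewrite mulrS pwD IH exprS. Qed.

Lemma pwN n : pw a a' (- n) = pw a' a n.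
Proof.
have a'a : a' * a = 1 by rewrite mulrC.
case: n => [[|j]|j]; rewrite //= -?NegzE //.
Qed.

End Power.

Lemma pwM (A : comAlgType k) (a a' b b' : A) n :
  pw (a * b) (a' * b') n = pw a a' n * pw b b' n.
Proof. by case: n => j; rewrite /= exprMn. Qed.

End Points.
Arguments pw : simpl never.

(** * Scalar extension of matrices and expansion in a nilpotent parameter *)

Section Ext.

Variable k : closedFieldType.

Lemma extmxM (A : comAlgType k) m n l (X : 'M[k]_(m, n)) (Y : 'M[k]_(n, l)) :
  extmx A (X *m Y) = extmx A X *m extmx A Y.
Proof. exact: map_mxM. Qed.
Lemma extmx1 (A : comAlgType k) n : extmx A (1%:M : 'M[k]_n) = 1%:M.
Proof. exact: map_mx1. Qed.
Lemma extmx0 (A : comAlgType k) m n : extmx A (0 : 'M[k]_(m, n)) = 0.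
Proof. exact: map_mx0. Qed.
Lemma extmxD (A : comAlgType k) m n (X Y : 'M[k]_(m, n)) :
  extmx A (X + Y) = extmx A X + extmx A Y.
Proof. exact: map_mxD. Qed.
Lemma extmxB (A : comAlgType k) m n (X Y : 'M[k]_(m, n)) :
  extmx A (X - Y) = extmx A X - extmx A Y.
Proof. exact: map_mxB. Qed.
Lemma extmxZ (A : comAlgType k) m n c (X : 'M[k]_(m, n)) :
  extmx A (c *: X) = c%:A *: extmx A X.
Proof. exact: map_mxZ. Qed.
Lemma extmx_sum (A : comAlgType k) m n I (s : seq I) (P : pred I) (F : I -> 'M[k]_(m, n)) :
  extmx A (\sum_(i <- s | P i) F i) = \sum_(i <- s | P i) extmx A (F i).
Proof. exact: map_mx_sum. Qed.

Lemma map_extmx (A B : comAlgType k) (u : {lrmorphism A -> B}) m n (X : 'M[k]_(m, n)) :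
  map_mx u (extmx A X) = extmx B X.
Proof. by apply/matrixP => i j; rewrite !mxE rmorph_alg. Qed.

Lemma extmx_k m n (X : 'M[k]_(m, n)) : extmx k^o X = X.
Proof. by apply/matrixP => i j; rewrite !mxE; apply: mulr1. Qed.

End Ext.

Section NilExpand.

Variables (k : closedFieldType) (q : nat).
Hypothesis q_gt0 : (0 < q)%N.

(** Morphisms from the scheme x^q = 0 to matrices; values at other x are irrelevant. *)
Definition nilnat m n (Z : forall A : comAlgType k, A -> 'M[A]_(m, n)) :=
  forall (A B : comAlgType k) (u : {lrmorphism A -> B}) x, x ^+ q = 0 ->
    Z B (u x) = map_mx u (Z A x).

Definition tc (A : comAlgType k) m n (j : nat) (M : 'M[trunc A q]_(m, n)) : 'M[A]_(m, n) :=
  map_mx (@adjcoef k A 'X^q j) M.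

Definition nilcoef m n (Z : forall A : comAlgType k, A -> 'M[A]_(m, n)) (i : nat) : 'M[k]_(m,
  n) :=
  tc i (Z (trunc k^o q) (adjX _)).

(** Yoneda: every value is a specialisation of the one at the universal point X of k[X]/(X^q), whose
    coefficients are the [nilcoef]. *)
Lemma nil_expand m n (Z : forall A : comAlgType k, A -> 'M[A]_(m, n)) : nilnat Z ->
  forall (A : comAlgType k) (x : A), x ^+ q = 0 ->
    Z A x = \sum_(i < q) x ^+ i *: extmx A (nilcoef Z i).
Proof.
move=> Zn A x hx.
have := Zn _ _ (trunc_ev q_gt0 hx) (adjX _) (trunc_nil _ q_gt0).
rewrite [_ (adjX _)](trunc_evX q_gt0 hx) => ->; apply/matrixP => i j.
rewrite mxE (trunc_evE q_gt0 hx) summxE; apply: eq_bigr => l _.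
by rewrite !mxE mulr_algr.
Qed.

Section Coef.

Variable A : comAlgType k.
Local Notation C := (adjC ('X^q : {poly A})).
Local Notation X := (adjX ('X^q : {poly A})).

Lemma tcD m n j (M N : 'M[trunc A q]_(m, n)) : tc j (M + N) = tc j M + tc j N.
Proof. exact: map_mxD. Qed.
Lemma tc_sum m n j I (s : seq I) (P : pred I) (F : I -> 'M[trunc A q]_(m, n)) :
  tc j (\sum_(i <- s | P i) F i) = \sum_(i <- s | P i) tc j (F i).
Proof. exact: map_mx_sum. Qed.

Lemma tc_mulC m n l j (L : 'M[A]_(m, n)) (M : 'M[trunc A q]_(n, l)) :
  tc j (map_mx C L *m M) = L *m tc j M.
Proof.
apply/matrixP => a b; rewrite !mxE raddf_sum; apply: eq_bigr => i _.
by rewrite !mxE /= adjcoefCM.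
Qed.

Lemma tc_mulCr m n l j (M : 'M[trunc A q]_(m, n)) (L : 'M[A]_(n, l)) :
  tc j (M *m map_mx C L) = tc j M *m L.
Proof.
apply/matrixP => a b; rewrite !mxE raddf_sum; apply: eq_bigr => i _.
by rewrite !mxE /= mulrC adjcoefCM mulrC.
Qed.

Lemma tc_ZC m n j (z : trunc A q) (M : 'M[A]_(m, n)) :
  tc j (z *: map_mx C M) = adjcoef j z *: M.
Proof. by apply/matrixP => a b; rewrite !mxE /= mulrC adjcoefCM mulrC. Qed.

Lemma extmx_trunc m n (M : 'M[k]_(m, n)) : extmx (trunc A q) M = map_mx C (extmx A M).
Proof. by rewrite (map_extmx (C : {lrmorphism A -> trunc A q})). Qed.

End Coef.

End NilExpand.

Lemma tc_CZ (k : closedFieldType) (A : comAlgType k) q m n j c (M : 'M[trunc A q]_(m, n)) :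
  tc j (adjC 'X^q c *: M) = c *: tc j M.
Proof. by apply/matrixP => a b; rewrite !mxE /= adjcoefCM. Qed.

(** * Integration over the Frobenius kernels *)

Section Modules.

Variables (k : closedFieldType) (p r : nat).
Hypothesis p_char : p \in [pchar k].

Local Notation q := (p ^ r)%N.
Local Notation GrT := (@GrT k p r _).
Local Notation GrTmod := (GrTmod k p r).

Let q0 : (0 < q)%N := q_gt0 r p_char.

Definition ub (b : bool) (A : comAlgType k) (x : A) : 'M[A]_2 :=
  if b then uu x else ul x.

(** Thus [sgw b 2] is the root of the root subgroup [ub b]. *)
Definition sgw (b : bool) (n : int) : int := if b then n else - n.

Lemma sgwMn b m n : sgw b (m * n%:Z) = sgw b m *+ n.
Proof. by case: b; rewrite /sgw ?mulNrn -mulr_natr natz. Qed.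

Lemma GrT_ub b (A : comAlgType k) (x : A) : x ^+ q = 0 -> GrT (ub b x).
Proof. by case: b => hx; [apply: GrT_uu | apply: GrT_ul]. Qed.

Lemma ubD b (A : comAlgType k) (x y : A) : ub b x *m ub b y = ub b (x + y).
Proof. by case: b; [apply: uuD | apply: ulD]. Qed.

Lemma ub0 b (A : comAlgType k) : ub b (0 : A) = 1%:M.
Proof. by case: b; [apply: uu0 | apply: ul0]. Qed.

Lemma map_ub b (A B : comAlgType k) (u : {lrmorphism A -> B}) x :
  map_mx u (ub b x) = ub b (u x).
Proof. by case: b; rewrite map_mx2 rmorph0 rmorph1. Qed.

Lemma hh_ub b (A : comAlgType k) (a a' x : A) : a * a' = 1 ->
  hh a a' *m ub b x = ub b (pw a a' (sgw b 2) * x) *m hh a a'.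
Proof.
by case: b => h; [rewrite /ub hh_uu | rewrite /ub hh_ul].
Qed.

Lemma map_hh (A B : comAlgType k) (u : {lrmorphism A -> B}) a a' :
  map_mx u (hh a a') = hh (u a) (u a').
Proof. by rewrite map_mx2 rmorph0. Qed.

Lemma act_ub_nat b (M : GrTmod) (A B : comAlgType k) (u : {lrmorphism A -> B}) x :
  x ^+ q = 0 -> act M (ub b (u x)) = map_mx u (act M (ub b x)).
Proof. by move=> hx; rewrite -map_ub act_nat ?GrT_ub. Qed.

Lemma act_ub_adjC b (M : GrTmod) (A : comAlgType k) (s : A) : s ^+ q = 0 ->
  act M (ub b (adjC 'X^q s : trunc A q)) = map_mx (adjC 'X^q) (act M (ub b s)).
Proof. exact: (act_ub_nat b M (adjC _ : {lrmorphism A -> trunc A q})). Qed.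

Lemma act_hh_nat (M : GrTmod) (A B : comAlgType k) (u : {lrmorphism A -> B}) a a' :
  a * a' = 1 -> act M (hh (u a) (u a')) = map_mx u (act M (hh a a')).
Proof. by move=> h; rewrite -map_hh act_nat ?GrT_hh. Qed.

Lemma act_hh_adjC (M : GrTmod) (A : comAlgType k) (a a' : A) : a * a' = 1 ->
  act M (hh (adjC 'X^q a : trunc A q) (adjC 'X^q a')) =
  map_mx (adjC 'X^q) (act M (hh a a')).
Proof. exact: (act_hh_nat M (adjC _ : {lrmorphism A -> trunc A q})). Qed.

Lemma act_ubD b (M : GrTmod) (A : comAlgType k) (x y : A) :
  x ^+ q = 0 -> y ^+ q = 0 -> act M (ub b (x + y)) = act M (ub b x) *m act M (ub b y).
Proof. by move=> hx hy; rewrite -ubD actM ?GrT_ub. Qed.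

Lemma act_ubK b (M : GrTmod) (A : comAlgType k) (x : A) :
  x ^+ q = 0 -> act M (ub b (- x)) *m act M (ub b x) = 1%:M.
Proof. by move=> hx; rewrite -act_ubD ?nilN // addNr ub0 act1. Qed.

Lemma act_ubKV b (M : GrTmod) (A : comAlgType k) (x : A) :
  x ^+ q = 0 -> act M (ub b x) *m act M (ub b (- x)) = 1%:M.
Proof. by move=> hx; rewrite -act_ubD ?nilN // addrN ub0 act1. Qed.

Lemma act_hhK (M : GrTmod) (A : comAlgType k) (a a' : A) :
  a * a' = 1 -> act M (hh a a') *m act M (hh a' a) = 1%:M.
Proof.
move=> h; have h' : a' * a = 1 by rewrite mulrC.
by rewrite -actM ?GrT_hh // hhM h h' hh1 act1.
Qed.

Definition commutes (M N : GrTmod) (X : 'M[k]_(dim N, dim M)) (A : comAlgType k) (g :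
  'M[A]_2) :=
  extmx A X *m act M g = act N g *m extmx A X.

Lemma commutesM (M N : GrTmod) (X : 'M[k]_(dim N, dim M)) (A : comAlgType k) (g h : 'M[A]_2) :
  GrT g -> GrT h -> commutes X g -> commutes X h -> commutes X (g *m h).
Proof.
move=> Gg Gh cg ch; rewrite /commutes !actM // mulmxA cg -mulmxA ch.
by rewrite mulmxA.
Qed.

(** Weight for the conjugation action of T on linear maps; weight 0 is T-equivariance. *)
Definition wt_hom (M N : GrTmod) (w : int) (X : 'M[k]_(dim N, dim M)) :=
  forall (A : comAlgType k) (a a' : A), a * a' = 1 ->
    act N (hh a a') *m extmx A X = pw a a' w *: (extmx A X *m act M (hh a a')).

Definition ub_hom b (M N : GrTmod) (X : 'M[k]_(dim N, dim M)) :=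
  forall (A : comAlgType k) (x : A), x ^+ q = 0 -> commutes X (ub b x).

Lemma hom_gen (M N : GrTmod) (X : 'M[k]_(dim N, dim M)) :
  ub_hom true X -> ub_hom false X -> wt_hom 0 X -> is_hom X.
Proof.
move=> hu hl ht A g /(GrT_decomp p_char)[x [y [a [a' [hx hy h ->]]]]].
apply: commutesM; try apply: commutesM; rewrite ?GrTM ?GrT_uu ?GrT_ul ?GrT_hh //.
- exact: hl.
- by rewrite /commutes ht // scale1r.
- exact: hu.
Qed.

Lemma hom_ub b (M N : GrTmod) (X : 'M[k]_(dim N, dim M)) : is_hom X -> ub_hom b X.
Proof. by move=> hX A x hx; apply/hX/GrT_ub. Qed.

Lemma hom_wt (M N : GrTmod) (X : 'M[k]_(dim N, dim M)) : is_hom X -> wt_hom 0 X.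
Proof. by move=> hX A a a' h; rewrite scale1r hX ?GrT_hh. Qed.

Lemma ul_uu_inv (A : comAlgType k) (s y c' : A) : (1 + s * y) * c' = 1 ->
  ul (- y) *m uu (- s) =
  uu (- (s * c')) *m (hh c' (1 + s * y) *m ul (- (y * c'))).
Proof.
move=> h; have h' : s * y * c' = 1 - c' by rewrite -h; ring.
by rewrite !mx2M; congr mx2; ring: h'.
Qed.

Section Trace.

Definition conjub b (M N : GrTmod) (X : 'M[k]_(dim N, dim M)) (A : comAlgType k) (x : A) :=
  act N (ub b x) *m extmx A X *m act M (ub b (- x)).

Lemma conjub_nat b M N (X : 'M[k]_(dim N, dim M)) : nilnat q (conjub b X).
Proof.
move=> A B u x hx; rewrite /conjub -rmorphN !act_ub_nat ?nilN //.
by rewrite !map_mxM map_extmx.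
Qed.

(* The Haar integral over the Frobenius kernel of a root subgroup. *)
Definition tr b (M N : GrTmod) (X : 'M[k]_(dim N, dim M)) : 'M[k]_(dim N, dim M) :=
  nilcoef q (conjub b X) q.-1.

Variables M N : GrTmod.
Implicit Type X : 'M[k]_(dim N, dim M).

Lemma conjub_expand b X (A : comAlgType k) (x : A) : x ^+ q = 0 ->
  conjub b X x = \sum_(i < q) x ^+ i *: extmx A (nilcoef q (conjub b X) i).
Proof. by move=> hx; rewrite (nil_expand q0 (conjub_nat b X)). Qed.

(** Change of variables: the universal parameter may be replaced by any nilpotent y with density c,
    provided c y^i has the same integral as X^i for all i < q. *)
Lemma tc_conjub b X (A : comAlgType k) (c y : trunc A q) : y ^+ q = 0 ->
  (forall i, (i < q)%N -> adjcoef q.-1 (c * y ^+ i) = (i == q.-1)%:R) ->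
  tc q.-1 (c *: conjub b X y) = extmx A (tr b X).
Proof.
move=> hy hc; rewrite conjub_expand // scaler_sumr tc_sum.
have q1 : (q.-1 < q)%N by rewrite prednK.
rewrite (bigD1 (Ordinal q1)) //= extmx_trunc scalerA tc_ZC hc // eqxx scale1r.
rewrite big1 ?addr0 // => i ne; rewrite extmx_trunc scalerA tc_ZC hc //.
by case: eqP => [e|_]; rewrite ?scale0r //; case/eqP: ne; apply/val_inj.
Qed.

Lemma conjubD b X (A : comAlgType k) (s x : A) : s ^+ q = 0 -> x ^+ q = 0 ->
  conjub b X (s + x) = act N (ub b s) *m conjub b X x *m act M (ub b (- s)).
Proof.
move=> hs hx; have ns := nilN p_char hs; have nx := nilN p_char hx.
rewrite /conjub (act_ubD b N hs hx) opprD [- s + _]addrC.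
by rewrite (act_ubD b M nx ns) !mulmxA.
Qed.

Lemma tc_conjub1 b X (A : comAlgType k) (y : trunc A q) : y ^+ q = 0 ->
  (forall i, (i < q)%N -> adjcoef q.-1 (y ^+ i) = (i == q.-1)%:R) ->
  tc q.-1 (conjub b X y) = extmx A (tr b X).
Proof.
move=> hy h; rewrite -[conjub b X y]scale1r; apply: tc_conjub => // i iq.
by rewrite mul1r h.
Qed.

(** Conjugation by u(s) replaces the parameter x by s + x, which does not change the integral
    ([coef_shift]). *)
Lemma tr_ub_hom b X : ub_hom b (tr b X).
Proof.
move=> A s hs; set x : trunc A q := adjX _; set S : trunc A q := adjC _ s.
have hx : x ^+ q = 0 by apply: trunc_nil.
have hS : S ^+ q = 0 by rewrite -rmorphXn hs rmorph0.
have aN := act_ub_adjC b N hs; have aM := act_ub_adjC b M (nilN p_char hs).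
rewrite adjCN -/S in aN aM.
have cx i : (i < q)%N -> adjcoef q.-1 (x ^+ i) = (i == q.-1)%:R by apply: trunc_coefX.
have cSx i : (i < q)%N -> adjcoef q.-1 ((S + x) ^+ i) = (i == q.-1)%:R by apply: coef_shift.
clearbody S x; have := conjubD b X hS hx; rewrite aN aM => /(congr1 (tc q.-1)).
rewrite tc_mulCr tc_mulC (tc_conjub1 b X hx cx).
rewrite (tc_conjub1 b X (nilD p_char hS hx) cSx) => e.
by rewrite /commutes [X in X *m _]e -mulmxA act_ubK // mulmx1.
Qed.

Lemma conjub_hh b X w (A : comAlgType k) (a a' x : A) :
  wt_hom w X -> a * a' = 1 -> x ^+ q = 0 ->
  act N (hh a a') *m conjub b X x =
  pw a a' w *: (conjub b X (pw a a' (sgw b 2) * x) *m act M (hh a a')).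
Proof.
move=> wX h hx; have hy := nilM (pw a a' (sgw b 2)) hx.
rewrite /conjub !mulmxA -actM ?GrT_ub ?GrT_hh // hh_ub // actM ?GrT_ub ?GrT_hh //.
rewrite -[_ *m act N (hh a a') *m _]mulmxA (wX _ _ _ h) -scalemxAr -scalemxAl.
congr (_ *: _); rewrite -!mulmxA -!actM ?GrT_ub ?GrT_hh ?nilN //.
by rewrite hh_ub // mulrN.
Qed.

(** T scales x by the root, so the coefficient of x^(q-1) gains q - 1 times that root. *)
Lemma tr_wt b X w : wt_hom w X -> wt_hom (w + sgw b (2 * q.-1%:Z)) (tr b X).
Proof.
move=> wX A a a' h; set x : trunc A q := adjX _.
pose C : {lrmorphism A -> trunc A q} := adjC _; set d := sgw b (2 * q.-1%:Z).
have hx : x ^+ q = 0 by apply: trunc_nil.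
have hC : C a * C a' = 1 by rewrite -rmorphM h rmorph1.
have aN := act_hh_adjC N h; have aM := act_hh_adjC M h.
have pE n : adjC 'X^q (pw a a' n) = pw (C a) (C a') n := map_pw C a a' n.
rewrite -[adjC _ a]/(C a) -[adjC _ a']/(C a') in aN aM.
have cx i : (i < q)%N -> adjcoef q.-1 (x ^+ i) = (i == q.-1)%:R by apply: trunc_coefX.
move: (C a) (C a') hC aN aM pE => c c' hC aN aM pE.
have dE : pw c c' d = pw c c' (sgw b 2) ^+ q.-1 by rewrite -pwMn // -sgwMn.
clearbody x; have := conjub_hh b wX hC hx; set y := _ * x => e.
have hy : y ^+ q = 0 by apply: nilM.
(* The density of weight -d cancels the factor of weight d that y^(q-1) carries relative to
   x^(q-1). *)
have cy i : (i < q)%N -> adjcoef q.-1 (adjC 'X^q (pw a a' (- d)) * y ^+ i) = (i == q.-1)%:R.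
  move=> iq; have yE : y ^+ i = adjC 'X^q (pw a a' (sgw b 2) ^+ i) * x ^+ i.
    by rewrite (rmorphXn (adjC _)) /= pE /y exprMn.
  rewrite yE !adjcoefCM cx //; have [->|ne] := eqVneq i q.-1; last by rewrite !mulr0.
  by rewrite mulr1 -pwMn // -sgwMn mulrC pwK.
clearbody y.
have {e} : map_mx (adjC 'X^q) (act N (hh a a')) *m conjub b X x =
    adjC 'X^q (pw a a' (w + d)) *:
      ((adjC 'X^q (pw a a' (- d)) *: conjub b X y) *m map_mx (adjC 'X^q) (act M (hh a a'))).
  by rewrite -aN -aM e -scalemxAl scalerA !pE -pwD // addrK.
move/(congr1 (tc q.-1)); rewrite tc_mulC tc_CZ tc_mulCr.
by rewrite (tc_conjub1 b X hx cx) (tc_conjub b X hy cy).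
Qed.

(* The two big cells: u^+ u^- = u^- h u^+ turns the invariance under U^+ of
   the integral over U^- into a change of variables. *)
Lemma conjub_mobius X (A : comAlgType k) (s x c' : A) :
    wt_hom (2 * q.-1%:Z) X -> ub_hom true X ->
    s ^+ q = 0 -> x ^+ q = 0 -> (1 + s * x) * c' = 1 ->
  act N (uu s) *m conjub false X x *m act M (uu (- s)) =
  (1 + s * x) ^+ (q.-1 + q.-1) *: conjub false X (x * c').
Proof.
move=> wX uX hs hx; set c := 1 + s * x => cc'.
have c'c : c' * c = 1 by rewrite mulrC.
have nx := nilN p_char hx; have ns := nilN p_char hs.
have xc : (x * c') ^+ q = 0 by rewrite mulrC; apply: nilM.
have sc : (s * c') ^+ q = 0 by rewrite mulrC; apply: nilM.
have nxc := nilN p_char xc; have nsc := nilN p_char sc.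
have e1 : uu s *m ul x = ul (x * c') *m hh c c' *m uu (s * c') by apply: uu_ul.
have e2 : ul (- x) *m uu (- s) = uu (- (s * c')) *m (hh c' c *m ul (- (x * c'))).
  exact: ul_uu_inv.
rewrite /conjub /ub !mulmxA -actM ?GrT_uu ?GrT_ul // e1.
rewrite -!mulmxA -actM ?GrT_uu ?GrT_ul // e2.
rewrite !actM ?GrTM ?GrT_uu ?GrT_ul ?GrT_hh // !mulmxA.
have := uX _ _ sc; rewrite /commutes /ub => uX'.
rewrite -[_ *m act N (uu _) *m extmx A X]mulmxA -uX' !mulmxA.
rewrite -[_ *m act M (uu _) *m act M (uu _)]mulmxA (act_ubKV true) // mulmx1.
rewrite -[_ *m act N (hh _ _) *m _]mulmxA (wX _ _ _ cc') -scalemxAr -!scalemxAl.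
rewrite [_ *m (extmx _ _ *m _)]mulmxA -[_ *m _ *m act M (hh _ _)]mulmxA act_hhK // mulmx1.
congr (_ *: _); rewrite -natz mulr_natr pwMn // -[pw _ _ 2]/(c ^+ 2) -exprM.
by rewrite mul2n addnn.
Qed.

(** The weight of X supplies exactly the density (1 + sx)^(2(q-1)) with which x -> x/(1+sx)
    preserves the integral ([coef_mobius]). *)
Lemma tr_opp_hom X : wt_hom (2 * q.-1%:Z) X -> ub_hom true X -> ub_hom true (tr false X).
Proof.
move=> wX uX A s hs; set x : trunc A q := adjX _; set S : trunc A q := adjC _ s.
have hx : x ^+ q = 0 by apply: trunc_nil.
have hS : S ^+ q = 0 by rewrite -rmorphXn hs rmorph0.
have aN := act_ub_adjC true N hs; have aM := act_ub_adjC true M (nilN p_char hs).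
rewrite adjCN -/S in aN aM.
have cx i : (i < q)%N -> adjcoef q.-1 (x ^+ i) = (i == q.-1)%:R by apply: trunc_coefX.
have c1 : (1 + S * x) ^+ q = 1 by apply: frob_unit.
have cc' := frob_inv p_char c1; set c' := _ ^+ q.-1 in cc'.
have cm i : (i < q)%N -> adjcoef q.-1
  ((1 + S * x) ^+ (q.-1 + q.-1) * (x * c') ^+ i) = (i == q.-1)%:R.
  by move=> iq; apply: coef_mobius.
clearbody S x c'; have xc : (x * c') ^+ q = 0 by rewrite mulrC; apply: nilM.
have := conjub_mobius wX uX hS hx cc'; rewrite /ub in aN aM; rewrite aN aM.
move=> /(congr1 (tc q.-1)).
rewrite tc_mulCr tc_mulC (tc_conjub1 false X hx cx) (tc_conjub false X xc cm) => e.
by rewrite /commutes -[X in X *m _]e -mulmxA (act_ubK true) // mulmx1.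
Qed.

End Trace.

End Modules.

(** * Weight spaces *)

Section TorusCocycle.

Variables (k : closedFieldType) (p : nat).
Hypothesis p_char : p \in [pchar k].

Lemma exists_expr_neq1 (n : nat) : (0 < n)%N -> exists b : k, b != 0 /\ b ^+ n != 1.
Proof.
move=> n0; have /closed_nonrootP[b] : ('X^n - 1%:P) * 'X != 0 :> {poly k}.
  by rewrite mulf_neq0 ?polyX_eq0 // monic_neq0 // monicXnsubC.
rewrite /root !hornerE mulf_eq0 subr_eq0 negb_or => /andP[bn b0].
by exists b.
Qed.

Lemma exists_pw_neq (mu lam : int) : mu != lam ->
  exists b b' : k^o, b * b' = 1 /\ pw b b' mu != pw b b' lam.
Proof.
move=> ne; have n0 : (0 < `|mu - lam|)%N by rewrite absz_gt0 subr_eq0.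
have [b [b0 bn]] := exists_expr_neq1 n0; exists b, b^-1.
have h : (b : k^o) * (b^-1 : k^o) = 1 by apply: divff.
split=> //; apply: contra bn => /eqP e.
have e1 : pw (b : k^o) b^-1 (mu - lam) = 1 by rewrite pwD // e pwK.
case: (mu - lam) e1 => n /=; rewrite /pw => e1; first exact/eqP.
by rewrite -(inj_eq invr_inj) invr1 -exprVn; apply/eqP.
Qed.

Lemma pwX (A : comAlgType k) (a a' : A) n j :
  pw (a ^+ j) (a' ^+ j) n = pw a a' n ^+ j.
Proof.
elim: j => [|j IH]; last by rewrite !exprS pwM IH.
by case: n => m; rewrite /pw expr1n.
Qed.

Variable D : forall A : comAlgType k, A -> A -> A.
Variables mu lam : int.
Hypothesis D_nat : forall (A B : comAlgType k) (u : {lrmorphism A -> B}) a a',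
  a * a' = 1 -> D (u a) (u a') = u (D a a').
Hypothesis D_cocycle : forall (A : comAlgType k) (a a' b b' : A),
  a * a' = 1 -> b * b' = 1 ->
  D (a * b) (a' * b') = pw b b' mu * D a a' + pw a a' lam * D b b'.

(* For mu <> lam commutativity of T suffices; for mu = lam the cocycle is a
   homomorphism to the additive group and every point is locally a p-th power. *)
Lemma cocycle_coboundary : exists e : k, forall (A : comAlgType k) (a a' : A),
  a * a' = 1 -> D a a' = (pw a a' mu - pw a a' lam) * e%:A.
Proof.
have [eml|ne] := eqVneq mu lam; last first.
  have [b [b' [h bne]]] := exists_pw_neq ne.
  (* Expanding D(ab) = D(ba) at a fixed k-point b that separates mu from lam determines D(a). *)
  exists ((pw b b' mu - pw b b' lam)^-1 * D b b') => A a a' ha.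
  pose u : {lrmorphism k^o -> A} := @scalars k A.
  have uh : u b * u b' = 1 by rewrite -rmorphM h rmorph1.
  have := D_cocycle uh ha; rewrite [u b * a]mulrC [u b' * a']mulrC.
  rewrite (D_cocycle ha uh) => e.
  have {}e : D a a' * u (pw b b' mu - pw b b' lam) = (pw a a' mu - pw a a' lam) * u (D b b').
    have uE n : u (pw b b' n) = pw (u b) (u b') n := map_pw u b b' n.
    rewrite -D_nat // rmorphB /= !uE.
    by apply/eqP; rewrite -subr_eq0; apply/eqP; move/eqP: e; rewrite -subr_eq0 => /eqP <-;
      ring.
  have n0 : pw b b' mu - pw b b' lam != 0 by rewrite subr_eq0.
  rewrite -[_%:A]/(u _) (rmorphM u) mulrCA -e mulrCA -(rmorphM u) mulVf //.
  by rewrite rmorph1 mulr1.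
exists 0 => A a a' h; rewrite scale0r mulr0.
have p_gt1 : (1 < p)%N := prime_gt1 (pcharf_prime p_char).
(* For mu = lam, D(y^p) is a multiple of p, hence zero. *)
have DX (B : comAlgType k) (y y' : B) n : y * y' = 1 ->
    D (y ^+ n.+1) (y' ^+ n.+1) = (pw y y' lam ^+ n * D y y') *+ n.+1.
  move=> hy; elim: n => [|n IH]; first by rewrite !expr1 mul1r.
  have hyn : y ^+ n.+1 * y' ^+ n.+1 = 1 by rewrite -exprMn hy expr1n.
  rewrite [y ^+ n.+2]exprS [y' ^+ n.+2]exprS D_cocycle // IH eml.
  by rewrite [in RHS]mulrS mulrnAr mulrA -exprS pwX.
(* With y^p = a and inverse y^(p-1) a' of y, D(a) vanishes in the radical extension, into which A
   embeds. *)
pose y : radical p a := radX p a.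
pose C : {lrmorphism A -> radical p a} := radC p a.
have yp : y ^+ p = C a by apply: radXp.
have pE : p = p.-1.+1 by rewrite prednK // ltnW.
have hy : y * (y ^+ p.-1 * C a') = 1 by rewrite mulrA -exprS -pE yp -rmorphM h rmorph1.
have y'p : (y ^+ p.-1 * C a') ^+ p = C a'.
  rewrite exprMn exprAC yp -!rmorphXn -rmorphM; congr (C _).
  by rewrite {2}pE exprS mulrCA -exprMn h expr1n mulr1.
have := DX _ _ _ p.-1 hy; rewrite -pE yp y'p D_nat // -mulr_natr.
by rewrite (pcharf0 (alg_pchar p_char _)) mulr0 -[0](rmorph0 C) => /radC_inj.
Qed.

End TorusCocycle.

(** * Linearity of the integrals; vectors as maps from the trivial module *)

Section Linear.

Variables (k : closedFieldType) (p r : nat).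
Hypothesis p_char : p \in [pchar k].

Local Notation q := (p ^ r)%N.
Local Notation GrTmod := (GrTmod k p r).
Let q0 : (0 < q)%N := q_gt0 r p_char.

Lemma trM_r b (L M N : GrTmod) (X : 'M[k]_(dim N, dim M)) (Z : 'M[k]_(dim M, dim L)) :
  ub_hom b Z -> tr b (M := L) (N := N) (X *m Z) = tr b X *m Z.
Proof.
move=> hZ; rewrite /tr /nilcoef.
have hx : (adjX 'X^q : trunc k^o q) ^+ q = 0 by apply: trunc_nil.
rewrite /conjub extmxM -!mulmxA (hZ _ _ (nilN p_char hx)) !mulmxA.
by rewrite [X in tc _ (_ *m X)]extmx_trunc tc_mulCr extmx_k.
Qed.

Lemma trM_l b (L M N : GrTmod) (Y : 'M[k]_(dim N, dim M)) (X : 'M[k]_(dim M, dim L)) :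
  ub_hom b Y -> tr b (M := L) (N := N) (Y *m X) = Y *m tr b X.
Proof.
move=> hY; rewrite /tr /nilcoef.
have hx : (adjX 'X^q : trunc k^o q) ^+ q = 0 by apply: trunc_nil.
rewrite /conjub extmxM !mulmxA -(hY _ _ hx) -!mulmxA.
by rewrite [X in tc _ (X *m _)]extmx_trunc tc_mulC extmx_k.
Qed.

Lemma trD b (M N : GrTmod) (X Y : 'M[k]_(dim N, dim M)) :
  tr b (X + Y) = tr b X + tr b Y.
Proof. by rewrite /tr /nilcoef /conjub extmxD mulmxDr mulmxDl tcD. Qed.

Lemma tr0 b (M N : GrTmod) : tr b (0 : 'M[k]_(dim N, dim M)) = 0.
Proof. by apply: (addIr (tr b 0)); rewrite -trD !add0r. Qed.

Lemma tr_sum b (M N : GrTmod) I (s : seq I) (P : pred I) (F : I -> 'M[k]_(dim N, dim M)) :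
  tr b (\sum_(i <- s | P i) F i) = \sum_(i <- s | P i) tr b (F i).
Proof. by apply: (big_morph _ (@trD b M N) (tr0 b M N)). Qed.

(* The integral over G_r T / T. *)
Definition Tr (M N : GrTmod) (X : 'M[k]_(dim N, dim M)) := tr false (tr true X).

(** The weight goes from 0 to 2(q-1) and back to 0; the intermediate weight is the one that
    [tr_opp_hom] requires to preserve U_r^+ -equivariance. *)
Lemma Tr_hom (M N : GrTmod) (X : 'M[k]_(dim N, dim M)) : wt_hom 0 X -> is_hom (Tr X).
Proof.
move=> h0; have h1 := tr_wt p_char true h0; have h2 := tr_wt p_char false h1.
rewrite add0r /sgw in h1; rewrite add0r /sgw subrr in h2.
apply: (hom_gen p_char) => //; last exact: tr_ub_hom.
by apply: tr_opp_hom => //; apply: tr_ub_hom.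
Qed.

Fact triv_act1 (A : comAlgType k) : (1%:M : 'M[A]_1) = 1%:M. Proof. by []. Qed.
Fact triv_actM (A : comAlgType k) (g h : 'M[A]_2) :
  GrT p r g -> GrT p r h -> (1%:M : 'M[A]_1) = 1%:M *m 1%:M.
Proof. by rewrite mulmx1. Qed.
Fact triv_act_nat (A B : comAlgType k) (u : {lrmorphism A -> B}) (g : 'M[A]_2) :
  GrT p r g -> 1%:M = map_mx u (1%:M : 'M[A]_1).
Proof. by rewrite map_mx1. Qed.

(* A vector of M is a linear map triv -> M. *)
Definition triv : GrTmod := @GrTMod k p r 1 (fun A _ => 1%:M) triv_act1 triv_actM triv_act_nat.

Definition vwt (M : GrTmod) n (v : 'cV[k]_(dim M)) := @wt_hom k p r triv M n v.
Definition vinv b (M : GrTmod) (v : 'cV[k]_(dim M)) := @ub_hom k p r b triv M v.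
(* The divided power E^(q-1), for b = true, or F^(q-1) applied to v. *)
Definition vtop b (M : GrTmod) (v : 'cV[k]_(dim M)) : 'cV[k]_(dim M) := @tr k p r b triv M v.

Lemma vwtE (M : GrTmod) n (v : 'cV[k]_(dim M)) : vwt n v <->
  (forall (A : comAlgType k) (a a' : A), a * a' = 1 ->
    act M (hh a a') *m extmx A v = pw a a' n *: extmx A v).
Proof. by split=> h A a a' e; have := h A a a' e; rewrite /= mulmx1. Qed.

Lemma vinvE b (M : GrTmod) (v : 'cV[k]_(dim M)) : vinv b v <->
  (forall (A : comAlgType k) (x : A), x ^+ q = 0 -> act M (ub b x) *m extmx A v = extmx A v).
Proof. by split=> h A x e; have := h A x e; rewrite /commutes /= mulmx1. Qed.

Lemma wt_homM (L M N : GrTmod) m n (X : 'M[k]_(dim N, dim M)) (Y : 'M[k]_(dim M, dim L)) :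
  wt_hom m X -> wt_hom n Y -> @wt_hom k p r L N (m + n) (X *m Y).
Proof.
move=> hX hY A a a' h; rewrite extmxM mulmxA hX // -scalemxAl -mulmxA hY //.
by rewrite -scalemxAr scalerA pwD // !mulmxA.
Qed.

Lemma ub_homM b (L M N : GrTmod) (X : 'M[k]_(dim N, dim M)) (Y : 'M[k]_(dim M, dim L)) :
  ub_hom b X -> ub_hom b Y -> @ub_hom k p r b L N (X *m Y).
Proof.
move=> hX hY A x h; rewrite /commutes extmxM -mulmxA hY // mulmxA hX //.
by rewrite !mulmxA.
Qed.

Lemma wt_homD (M N : GrTmod) n (X Y : 'M[k]_(dim N, dim M)) :
  wt_hom n X -> wt_hom n Y -> wt_hom n (X + Y).
Proof.
by move=> hX hY A a a' h; rewrite extmxD mulmxDr hX // hY // -scalerDr mulmxDl.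
Qed.

Lemma wt_homZ (M N : GrTmod) n c (X : 'M[k]_(dim N, dim M)) :
  wt_hom n X -> wt_hom n (c *: X).
Proof.
move=> hX A a a' h; rewrite extmxZ -scalemxAr hX // -scalemxAl.
by rewrite !scalerA mulrC.
Qed.

Lemma is_homB (M N : GrTmod) (X Y : 'M[k]_(dim N, dim M)) :
  is_hom X -> is_hom Y -> is_hom (X - Y).
Proof. by move=> hX hY A g Gg; rewrite extmxB mulmxBl mulmxBr hX // hY. Qed.

Lemma is_homM (L M N : GrTmod) (X : 'M[k]_(dim N, dim M)) (Y : 'M[k]_(dim M, dim L)) :
  is_hom X -> is_hom Y -> @is_hom k p r L N (X *m Y).
Proof.
by move=> hX hY A g Gg; rewrite extmxM -mulmxA hY // mulmxA hX // mulmxA.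
Qed.

End Linear.

Section Weights.

Variables (k : closedFieldType) (p r : nat).
Hypothesis p_char : p \in [pchar k].

Local Notation q := (p ^ r)%N.
Local Notation GrTmod := (GrTmod k p r).

Lemma col_mulmx (R : comNzRingType) m n l (X : 'M[R]_(m, n)) (Y : 'M[R]_(n, l)) j :
  col j (X *m Y) = X *m col j Y.
Proof. by rewrite !colE mulmxA. Qed.

Lemma cols_choice (m n : nat) (Q : 'I_n -> 'cV[k]_m -> Prop) :
  (forall j, exists v, Q j v) ->
  exists X : 'M[k]_(m, n), forall j, Q j (col j X).
Proof.
move=> /fin_all_exists[f hf]; exists (\matrix_(a, j) f j a 0) => j.
suff -> : col j (\matrix_(a, j) f j a 0) = f j by [].
by apply/colP => a; rewrite !mxE.
Qed.

Lemma ses_split (M' M M'' : GrTmod) (i : 'M[k]_(dim M, dim M')) (s : 'M[k]_(dim M'', dim M)) :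
  short_exact i s -> exists S L, [/\ s *m S = 1%:M, L *m i = 1%:M, s *m i = 0
    & i *m L + S *m s = 1%:M].
Proof.
case=> hi hs inj surj ex.
have si0 : s *m i = 0.
  apply/matrixP => a b; have /ex : exists u, col b i = i *m u.
    by exists (delta_mx b 0); rewrite colE.
  by rewrite -col_mulmx => /colP/(_ a); rewrite !mxE.
have [S hS] : exists S : 'M[k]_(dim M, dim M''), forall j, col j 1%:M = s *m col j S.
  by apply: (cols_choice (Q := fun j v => col j 1%:M = s *m v)) => j; apply: surj.
have sS : s *m S = 1%:M.
  by apply/matrixP => a b; have /colP/(_ a) := hS b; rewrite -col_mulmx !mxE.
have [L hL] : exists L : 'M[k]_(dim M', dim M), forall j, col j (1%:M - S *m s) = i *m col j L.
  apply: (cols_choice (Q := fun j v => col j (1%:M - S *m s) = i *m v)) => j; apply/ex.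
  by rewrite -col_mulmx mulmxBr mulmx1 mulmxA sS mul1mx subrr; apply/colP => a; rewrite !mxE.
have iL : i *m L = 1%:M - S *m s.
  by apply/matrixP => a b; have /colP/(_ a) := hL b; rewrite -col_mulmx !mxE.
exists S, L; split=> //; last by rewrite iL subrK.
apply/eqP; rewrite -subr_eq0; apply/eqP/matrixP => a b.
have /inj/colP/(_ a) : i *m col b (L *m i - 1%:M) = 0.
  rewrite -col_mulmx mulmxBr mulmx1 mulmxA iL mulmxBl mul1mx -mulmxA si0 mulmx0 subr0 subrr.
  by apply/colP => c; rewrite !mxE.
by rewrite !mxE.
Qed.

Definition wts (M : GrTmod) n (lam : 'I_n -> int) (V : 'M[k]_(dim M, n)) :=
  forall j, vwt (lam j) (col j V).

Definition wtdiag (A : comAlgType k) (a a' : A) n (lam : 'I_n -> int) : 'M[A]_n :=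
  diag_mx (\row_j pw a a' (lam j)).

Lemma wtsE (M : GrTmod) n (lam : 'I_n -> int) (V : 'M[k]_(dim M, n)) :
  wts lam V <-> forall (A : comAlgType k) (a a' : A), a * a' = 1 ->
    act M (hh a a') *m extmx A V = extmx A V *m wtdiag a a' lam.
Proof.
split=> [h A a a' e|h j].
  apply/matrixP => i j; have /vwtE/(_ A a a' e)/colP/(_ i) := h j.
  rewrite mul_mx_diag !mxE mulrC => <-; apply: eq_bigr => l _.
  by rewrite !mxE.
apply/vwtE => A a a' e; have := h A a a' e; move/matrixP => {}h.
apply/colP => i; have := h i j; rewrite mul_mx_diag !mxE mulrC => <-.
by apply: eq_bigr => l _; rewrite !mxE.
Qed.

Lemma wtdiagD (A : comAlgType k) (a a' : A) n w (lam : 'I_n -> int) : a * a' = 1 ->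
  wtdiag a a' (fun j => w + lam j) = pw a a' w *: wtdiag a a' lam.
Proof.
move=> h; rewrite /wtdiag -[RHS]linearZ /=; congr diag_mx.
by apply/rowP => j; rewrite !mxE pwD.
Qed.

Definition wbasis (M : GrTmod) n (lam : 'I_n -> int)
    (V : 'M[k]_(dim M, n)) (W : 'M[k]_(n, dim M)) :=
  [/\ V *m W = 1%:M, W *m V = 1%:M & wts lam V].

(** Proved for induced modules by an explicit basis and carried up filtrations by
    [ses_semisimple]. *)
Definition T_semisimple (M : GrTmod) := exists n (lam : 'I_n -> int) (V : 'M[k]_(dim M, n)) W,
  wbasis lam V W.

Lemma wbasis_dual (M : GrTmod) n (lam : 'I_n -> int) (V : 'M[k]_(dim M, n)) W :
  wbasis lam V W -> forall (A : comAlgType k) (a a' : A), a * a' = 1 ->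
    extmx A W *m act M (hh a a') = wtdiag a a' lam *m extmx A W.
Proof.
case=> VW WV /wtsE h A a a' e.
rewrite -[LHS]mulmx1 -(extmx1 A (dim M)) -VW extmxM mulmxA.
rewrite -[_ *m act _ _ *m _]mulmxA h // !mulmxA -extmxM WV extmx1 mul1mx //.
Qed.

Lemma wts_hom (M N : GrTmod) n (lam : 'I_n -> int) (V : 'M[k]_(dim N, n)) W w
    (Z : 'M[k]_(dim M, n)) :
  wbasis lam V W -> wts (fun j => w + lam j) Z -> @wt_hom k p r N M w (Z *m W).
Proof.
move=> hV /wtsE hZ A a a' e; rewrite extmxM mulmxA hZ // wtdiagD // -scalemxAr -scalemxAl.
by rewrite -!mulmxA (wbasis_dual hV).
Qed.

Section ShortExact.

Variables M' M M'' : GrTmod.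
Variables (i : 'M[k]_(dim M, dim M')) (s : 'M[k]_(dim M'', dim M)).
Hypothesis ses : short_exact i s.

(** For any linear lift x0 of w, t x0 - mu(t) x0 lies in M' and is a cocycle in t. Its coordinates
    in a weight basis of M' are coboundaries by [cocycle_coboundary], and the constants found there
    correct x0. *)
Lemma weight_lift mu (w : 'cV[k]_(dim M'')) : T_semisimple M' -> vwt mu w ->
  exists x : 'cV[k]_(dim M), vwt mu x /\ s *m x = w.
Proof.
case=> n [lam [V [W hV]]] /vwtE hw.
have [S [L [sS Li si0 iLSs]]] := ses_split ses; case: ses => hi hs _ _ _.
pose x0 := S *m w.
pose C (A : comAlgType k) (a a' : A) := extmx A L *m (act M (hh a a') *m extmx A x0 - pw a a'
  mu *: extmx A x0).
have iC (A : comAlgType k) (a a' : A) : a * a' = 1 ->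
    extmx A i *m C A a a' = act M (hh a a') *m extmx A x0 - pw a a' mu *: extmx A x0.
  move=> e; rewrite /C mulmxA -extmxM.
  have -> : i *m L = 1%:M - S *m s by rewrite -iLSs addrK.
  rewrite extmxB extmx1 mulmxBl mul1mx extmxM -[extmx A S *m _ *m _]mulmxA mulmxBr.
  rewrite mulmxA hs ?GrT_hh // -mulmxA -extmxM mulmxA sS mul1mx hw //.
  by rewrite -scalemxAr -extmxM mulmxA sS mul1mx subrr mulmx0 subr0.
have C_nat (A B : comAlgType k) (u : {lrmorphism A -> B}) a a' :
    a * a' = 1 -> C B (u a) (u a') = map_mx u (C A a a').
  move=> e; rewrite /C act_hh_nat // map_mxM map_mxB map_mxM map_mxZ !map_extmx.
  by rewrite /= -[u (pw _ _ _)]/(u _) (map_pw u).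
have C_coc (A : comAlgType k) (a a' b b' : A) : a * a' = 1 -> b * b' = 1 ->
    C A (a * b) (a' * b') = pw b b' mu *: C A a a' + act M' (hh a a') *m C A b b'.
  move=> ea eb.
  have eab : (a * b) * (a' * b') = 1 by rewrite mulrACA ea eb mulr1.
  have inj (y z : 'cV[A]_(dim M')) : extmx A i *m y = extmx A i *m z -> y = z.
    by move=> h; rewrite -[y]mul1mx -[z]mul1mx -(extmx1 A) -Li extmxM -!mulmxA h.
  apply: inj; rewrite mulmxDr -scalemxAr !iC // mulmxA hi ?GrT_hh // -mulmxA iC //.
  rewrite -hhM actM ?GrT_hh // pwM mulmxBr -scalemxAr mulmxA scalerBr scalerA.
  rewrite [pw b b' mu * _]mulrC; set x := act _ _ *m act _ _ *m _; set y := _ *: (_ *m _).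
  by set z := _ *: _; rewrite [RHS]addrC addrA subrK.
have D_ex (j : 'I_n) : exists e : k, forall (A : comAlgType k) (a a' : A), a * a' = 1 ->
    (extmx A W *m C A a a') j 0 = (pw a a' mu - pw a a' (lam j)) * e%:A.
  apply: (cocycle_coboundary p_char (D := fun A a a' => (extmx A W *m C A a a') j 0)).
    move=> A B u a a' e; rewrite C_nat // -(map_extmx u) -map_mxM.
    by rewrite mxE.
  move=> A a a' b b' ea eb; rewrite C_coc // mulmxDr -scalemxAr mxE [X in X + _]mxE.
  by congr (_ + _); rewrite mulmxA (wbasis_dual hV) // -mulmxA mul_diag_mx !mxE.
have [f hf] := fin_all_exists D_ex; pose e : 'cV[k]_n := \col_j f j.
case: (hV) => VW WV /wtsE hwts.
have hD (A : comAlgType k) (a a' : A) : a * a' = 1 -> C A a a' = extmx A V *m (pw a a' mu *: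
  extmx A e - wtdiag a a' lam *m extmx A e).
  move=> h; rewrite -[LHS]mul1mx -(extmx1 A) -VW extmxM -mulmxA; congr (_ *m _).
  by apply/colP => j; rewrite hf // mul_diag_mx !mxE mulrBl.
exists (x0 + i *m (V *m e)); split; last first.
  by rewrite mulmxDr !mulmxA sS si0 !mul0mx addr0 mul1mx.
apply/vwtE => A a a' h; rewrite extmxD mulmxDr scalerDr (extmxM _ i) (extmxM _ V).
rewrite [act M _ *m (extmx A i *m _)]mulmxA -hi ?GrT_hh // -mulmxA [act M' _ *m _]mulmxA.
rewrite hwts // -[act M _ *m extmx A x0](subrK (pw a a' mu *: extmx A x0)) -iC // hD //.
rewrite addrAC addrC; congr (_ + _).
by rewrite -mulmxDr -[_ *m _ *m extmx A e]mulmxA -mulmxDr subrK -!scalemxAr.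
Qed.

(** Lifting a weight basis of M'' gives the T-equivariant section S; L is the complementary
    retraction. *)
Lemma ses_section : T_semisimple M' -> T_semisimple M'' -> exists S L,
  [/\ s *m S = 1%:M, L *m i = 1%:M, i *m L + S *m s = 1%:M, wt_hom 0 S & wt_hom 0 L].
Proof.
move=> ss' [n [lam [V [W hV]]]]; case: (hV) => VW WV hwts.
have [S0 [L0 [sS0 Li0 si0 iLSs0]]] := ses_split ses; case: ses => hi hs _ _ _.
have [Z hZ] : exists Z : 'M[k]_(dim M, n), forall j,
  vwt (lam j) (col j Z) /\ s *m col j Z = col j V.
  apply: (cols_choice (Q := fun j z => vwt (lam j) z /\ s *m z = col j V)) => j.
  exact: weight_lift.
have sZ : s *m Z = V.
  by apply/matrixP => a b; have [_ /colP/(_ a)] := hZ b; rewrite -col_mulmx !mxE.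
pose S := Z *m W; pose L := L0 *m (1%:M - S *m s).
have sS : s *m S = 1%:M by rewrite mulmxA sZ VW.
have iL : i *m L = 1%:M - S *m s.
  have e : i *m L0 = 1%:M - S0 *m s by rewrite -iLSs0 addrK.
  have sz : s *m (1%:M - S *m s) = 0 by rewrite mulmxBr mulmx1 mulmxA sS mul1mx subrr.
  by rewrite mulmxA e mulmxBl mul1mx -[S0 *m s *m _]mulmxA sz mulmx0 subr0.
have Li : L *m i = 1%:M by rewrite -mulmxA mulmxBl mul1mx -mulmxA si0 mulmx0 subr0.
have iLSs : i *m L + S *m s = 1%:M by rewrite iL subrK.
have LS : L *m S = 0 by rewrite -mulmxA mulmxBl mul1mx -mulmxA sS mulmx1 subrr mulmx0.
have wS : wt_hom 0 S.
  by apply: (wts_hom hV) => j; rewrite add0r; case: (hZ j).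
clearbody L S; exists S, L; split=> // A a a' h; rewrite scale1r.
have G : GrT p r (hh a a') by apply: GrT_hh.
rewrite -[RHS]mulmx1 -(extmx1 A) -iLSs extmxD mulmxDr !extmxM !mulmxA.
rewrite -[_ *m _ *m extmx A S]mulmxA wS // scale1r -[extmx A L *m _ *m extmx A i]mulmxA -hi //.
by rewrite !mulmxA -!extmxM Li LS extmx1 extmx0 !mul0mx mul1mx addr0.
Qed.

Lemma ses_semisimple : T_semisimple M' -> T_semisimple M'' -> T_semisimple M.
Proof.
move=> ss' ss''; have [S [L [sS Li iLSs wS _]]] := ses_section ss' ss''.
case: ss' => n' [lam' [V' [W' [VW' WV' hV']]]].
case: ss'' => n [lam [V [W [VW WV hV]]]].
case: ses => hi hs _ _ _; have [S0 [L0 [_ _ si _]]] := ses_split ses.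
have LS : L *m S = 0.
  have : (i *m L + S *m s) *m S = S by rewrite iLSs mul1mx.
  rewrite mulmxDl -[S *m s *m S]mulmxA sS mulmx1 => /(canRL (addrK _)).
  by rewrite subrr => e; rewrite -[L *m S]mul1mx -Li -[LHS]mulmxA (mulmxA i) e mulmx0.
pose lm (j : 'I_(n' + n)) := match split j with inl a => lam' a | inr b => lam b end.
exists (n' + n)%N, lm, (row_mx (i *m V') (S *m V)), (col_mx (W' *m L) (W *m s)); split.
- rewrite mul_row_col -!mulmxA [V' *m _]mulmxA VW' mul1mx [V *m _]mulmxA VW mul1mx.
  exact: iLSs.
- rewrite mul_col_row -!mulmxA [L *m (i *m _)]mulmxA Li mul1mx WV' [L *m (S *m _)]mulmxA LS.
  rewrite mul0mx mulmx0 [s *m (i *m _)]mulmxA si mul0mx mulmx0 [s *m (S *m _)]mulmxA sS.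
  by rewrite mul1mx WV -scalar_mx_block.
apply/wtsE => A a a' h; rewrite /extmx map_row_mx -!/(extmx _ _) mul_mx_row !extmxM !mulmxA.
rewrite -hi ?GrT_hh // wS // scale1r -[_ *m act M' _ *m _]mulmxA -[_ *m act M'' _ *m _]mulmxA.
move/wtsE: hV' => ->//; move/wtsE: hV => ->//.
have -> : wtdiag a a' lm = block_mx (wtdiag a a' lam') 0 0 (wtdiag a a' lam).
  rewrite /wtdiag -diag_mx_row; congr diag_mx; apply/rowP => j; rewrite !mxE /lm.
  by case: split => b; rewrite mxE.
by rewrite mul_row_block !mulmx0 addr0 add0r !mulmxA.
Qed.

End ShortExact.

End Weights.

(** * Standard and costandard modules *)

Section Induced.

Variables (k : closedFieldType) (p r : nat).
Hypothesis p_char : p \in [pchar k].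

Local Notation q := (p ^ r)%N.
Local Notation GrTmod := (GrTmod k p r).
Local Notation GrT := (@GrT k p r _).
Let q0 : (0 < q)%N := q_gt0 r p_char.

(* The inverse of the upper left entry a of a point of G_r T: (a d)^q = 1. *)
Definition ainv (A : comAlgType k) (g : 'M[A]_2) : A :=
  g ord_max ord_max * (g ord0 ord0 * g ord_max ord_max) ^+ q.-1.

Lemma inv_uniq (A : comAlgType k) (x y z : A) : x * y = 1 -> x * z = 1 -> y = z.
Proof. by move=> xy xz; rewrite -[y]mulr1 -xz mulrCA mulrA xy mul1r. Qed.

Lemma ainvP (A : comAlgType k) (g : 'M[A]_2) : GrT g -> g ord0 ord0 * ainv g = 1.
Proof.
elim/mx2_ind: g => a b c d; rewrite GrT_mx2 // => /and3P[/eqP e /eqP bq /eqP cq].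
rewrite /ainv !mxE /= mulrA; apply: frob_inv => //.
by rewrite -[a * d](subrK (b * c)) e frob_unit.
Qed.

(* The function y^i on U_r^-, extended to G_r T = U_r^- B_r^+ T. *)
Definition indfun (nu : int) (i : nat) (A : comAlgType k) (g : 'M[A]_2) : A :=
  pw (g ord0 ord0) (ainv g) (- nu) * (ainv g * g ord_max ord0) ^+ i.

Lemma indfunE nu i (A : comAlgType k) (a b c d a' : A) :
  GrT (mx2 a b c d) -> a * a' = 1 ->
  indfun nu i (mx2 a b c d) = pw a a' (- nu) * (a' * c) ^+ i.
Proof.
move=> G e; have -> : a' = ainv (mx2 a b c d).
  by apply: inv_uniq e _; rewrite -[RHS](ainvP G) mxE.
by rewrite /indfun !mxE.
Qed.

Lemma indfun_Ind nu i : in_Ind p r (@BrpT k p r) nu (indfun nu i).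
Proof.
split=> [A B u g Gg|A g h Gg].
  by rewrite /indfun /ainv !mxE rmorphM rmorphXn !(rmorphM u) map_pw !(rmorphM, rmorphXn) //.
rewrite /BrpT => /andP[Gh]; have Ggh := GrTM p_char Gg Gh; move: Gh Gg Ggh.
elim/mx2_ind: h => a b c d; elim/mx2_ind: g => x y z t.
rewrite trigT_mx2 => Gh Gg Ggh /eqP c0; rewrite c0 in Gh Ggh *.
have := Gh; rewrite GrT_mx2 // mulr0 subr0 => /and3P[/eqP ad _ _].
have xx' := ainvP Gg; set x' := ainv _ in xx'; rewrite mxE /= in xx'.
rewrite mx2M in Ggh *; rewrite !mulr0 !addr0 in Ggh *.
rewrite (indfunE _ _ Gg xx') chi_mx2 (@indfunE _ _ _ _ _ _ _ (x' * d) Ggh); last first.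
  by rewrite mulrACA xx' ad mulr1.
rewrite pwM -mulrA mulrCA [X in _ * X]mulrA pwK // mul1r; congr (_ * _ ^+ _).
by rewrite mulrACA [d * a]mulrC ad mulr1.
Qed.

Section IsoInd.

Variables (M : GrTmod) (nu : int).
Variable f : 'I_(dim M) -> forall A : comAlgType k, 'M[A]_2 -> A.
Hypothesis f_Ind : forall j, in_Ind p r (@BrpT k p r) nu (f j).
Hypothesis f_basis : forall e, in_Ind p r (@BrpT k p r) nu e ->
  exists! c : 'cV[k]_(dim M), forall (A : comAlgType k) (x : 'M[A]_2),
    GrT x -> e A x = \sum_j c j 0 *: f j x.
Hypothesis f_act : forall (A : comAlgType k) (g x : 'M[A]_2) j, GrT g -> GrT x ->
  f j (\adj g *m x) = \sum_i act M g i j * f i x.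

(** As G_r T = U_r^- B_r^+ T, an induced function is determined on U_r^-, where it is a polynomial
    in y of degree less than q. *)
Lemma Ind_cell (e : forall A : comAlgType k, 'M[A]_2 -> A) :
  in_Ind p r (@BrpT k p r) nu e -> exists c : 'I_q -> k,
  (forall (A : comAlgType k) (y : A), y ^+ q = 0 -> e A (ul y) = \sum_i c i *: y ^+ i) /\
  (forall (A : comAlgType k) (g : 'M[A]_2), GrT g -> e A g = \sum_i c i *: indfun nu i g).
Proof.
case=> e_reg e_eq.
pose Z (A : comAlgType k) (y : A) : 'M[A]_(1, 1) := (e A (ul y))%:M.
have Zn : nilnat q Z.
  move=> A B u y hy; rewrite /Z map_scalar_mx; congr (_%:M).
  by rewrite -[ul (u y)](map_ub false u) e_reg ?GrT_ul.
pose c (i : 'I_q) := nilcoef q Z i 0 0.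
have ce (A : comAlgType k) (y : A) : y ^+ q = 0 -> e A (ul y) = \sum_i c i *: y ^+ i.
  move=> hy; have /matrixP/(_ 0 0) := nil_expand q0 Zn hy; rewrite mxE mulr1n => ->.
  by rewrite summxE; apply: eq_bigr => i _; rewrite mxE [extmx _ _ _ _]mxE mulr_algr.
exists c; split=> // A g /(GrT_decomp p_char)[x [y [a [a' [hx hy h ->]]]]].
have Bh : BrpT p r (hh a a' *m uu x).
  by rewrite /BrpT GrTM ?GrT_hh ?GrT_uu //= mx2M trigT_mx2 !(mul0r, mulr0, add0r).
have Gg : GrT (ul y *m (hh a a' *m uu x)).
  by apply: GrTM; [|apply: GrT_ul | case/andP: Bh].
have := e_eq _ _ _ (GrT_ul p_char hy) Bh; rewrite mulmxA ce //.
move=> E; rewrite -[LHS]mul1r -(pwK h (- nu)) opprK -mulrA.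
rewrite mx2M chi_mx2 !(mulr1, mul0r, addr0, add0r) in E.
rewrite E mulr_sumr; apply: eq_bigr => i _; rewrite -scalerAr; congr (_ *: _).
have gE : ul y *m hh a a' *m uu x = mx2 a (a * x) (y * a) (y * (a * x) + a').
  by rewrite !mx2M; congr mx2; ring.
rewrite mulmxA gE in Gg; rewrite gE (indfunE _ _ Gg h); congr (_ * _ ^+ _).
by rewrite mulrCA [a' * a]mulrC h mulr1.
Qed.

(* Evaluating on the cell U_r^- identifies M with the span of the y^i. *)
Lemma Ind_struct : exists (V : 'M[k]_(dim M, q)) (W : 'M[k]_(q, dim M)),
  [/\ V *m W = 1%:M, W *m V = 1%:M &
    forall (A : comAlgType k) (g : 'M[A]_2) (l : 'I_q) (P : 'I_q -> A), GrT g ->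
      indfun nu l (\adj (map_mx (adjC 'X^q) g) *m ul (adjX _ : trunc A q)) =
        \sum_(m < q) (adjX _ : trunc A q) ^+ m * adjC _ (P m) ->
      act M g *m extmx A (col l V) = extmx A V *m (\col_m P m)].
Proof.
have [c hc] := fin_all_exists (fun j => Ind_cell (f_Ind j)).
(* W writes the given basis f in the functions y^i, and V below writes the y^i in the basis f. *)
pose W : 'M[k]_(q, dim M) := \matrix_(i, j) c j i.
have V_ex (i : 'I_q) : exists v : 'cV[k]_(dim M), forall (A : comAlgType k) (x : 'M[A]_2),
    GrT x -> indfun nu i x = \sum_j v j 0 *: f j x.
  by have [v [hv _]] := f_basis (indfun_Ind nu i); exists v.
have [V hV] := cols_choice V_ex.
have hcell (A : comAlgType k) (y : A) j : y ^+ q = 0 -> f j (ul y) = \sum_i W i j *: y ^+ i.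
  by move=> hy; have [E _] := hc j; rewrite E //; apply: eq_bigr => i _; rewrite mxE.
have indcell (A : comAlgType k) (y : A) (i : nat) : y ^+ q = 0 -> indfun nu i (ul y) = y ^+ i.
  by move=> hy; rewrite (indfunE _ _ (GrT_ul p_char hy) (mulr1 1)) /pw; case: (- nu) => n;
    rewrite expr1n !mul1r.
have cell_coef (A : comAlgType k) (z : 'cV[A]_(dim M)) (m : 'I_q) :
    adjcoef m (\sum_l adjC 'X^q (z l 0) * f l (ul (adjX _ :
      trunc A q))) = (extmx A W *m z) m 0.
  rewrite raddf_sum mxE; apply: eq_bigr => l _ /=; rewrite adjcoefCM mulrC mxE.
  rewrite hcell ?trunc_nil // raddf_sum (bigD1 m) //= big1 => [|i im].
    rewrite addr0; congr (_ * _); rewrite scale_adjC adjcoefCM.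
    by rewrite trunc_coefX // eqxx mulr1.
  rewrite scale_adjC adjcoefCM trunc_coefX //.
  by move: im; rewrite -val_eqE /= => /negbTE->; rewrite mulr0.
have XnC (A : comAlgType k) (P : 'I_q -> A) (m : 'I_q) :
    adjcoef m (\sum_(i < q) (adjX _ : trunc A q) ^+ i * adjC _ (P i)) = P m.
  rewrite raddf_sum (bigD1 m) //= mulrC adjcoefCM trunc_coefX // eqxx mulr1.
  rewrite big1 ?addr0 // => i im; rewrite mulrC adjcoefCM trunc_coefX //.
  by move: im; rewrite -val_eqE /= => /negbTE->; rewrite mulr0.
have VW : V *m W = 1%:M.
  apply/matrixP => i j; have [v [_ uv]] := f_basis (f_Ind j).
  have e1 : v = col j (V *m W).
    apply: uv => A x Gx; have [_ ->] := hc j => //.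
    under eq_bigr => l _ do rewrite (hV l _ _ Gx) scaler_sumr.
    rewrite exchange_big; apply: eq_bigr => m _ /=.
    rewrite [col _ _ _ _]mxE mxE scaler_suml; apply: eq_bigr => l _.
    by rewrite scalerA !mxE mulrC.
  have e2 : v = col j 1%:M.
    apply: uv => A x Gx; rewrite (bigD1 j) //= !mxE eqxx scale1r big1 ?addr0 // => l lj.
    by rewrite !mxE (negPf lj) scale0r.
  by have /colP/(_ i) := etrans (esym e1) e2; rewrite !mxE.
exists V, W; split=> //.
  apply/matrixP => i j; have hX : (adjX _ : trunc k^o q) ^+ q = 0 by apply: trunc_nil.
  have := hV j _ _ (GrT_ul p_char hX); rewrite indcell // => /(congr1 (adjcoef i)).
  rewrite trunc_coefX // => E; rewrite [RHS]mxE eq_sym [RHS]E.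
  rewrite (_ : (W *m V) i j = (extmx k^o W *m col j V) i 0); last first.
    by rewrite extmx_k -col_mulmx [RHS]mxE.
  rewrite -cell_coef; apply: (congr1 (@adjcoef k k^o 'X^q i)); apply: eq_bigr => l _.
  rewrite scale_adjC; congr (adjC _ _ * _).
  exact/esym/mulr1.
move=> A g l P Gg E; rewrite -[LHS]mul1mx -(extmx1 A) -VW extmxM -mulmxA; congr (_ *m _).
apply/colP => m; rewrite [in RHS]mxE -[RHS]XnC -E -cell_coef; congr (adjcoef _ _).
set X : trunc A q := adjX _ in E *; have GX : GrT (ul X) by apply: GrT_ul => //; apply:
  trunc_nil.
pose C : {lrmorphism A -> trunc A q} := adjC _.
have GC : GrT (map_mx (adjC 'X^q) g).
  move: Gg; elim/mx2_ind: g {E} => a b c' d; rewrite (map_mx2 C) !GrT_mx2 //.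
  by case/and3P=> /eqP e /eqP eb /eqP ec;
    rewrite -!rmorphM -rmorphB -!rmorphXn e eb ec rmorph1 rmorph0 !eqxx.
have GG := GrTM p_char (GrT_adj p_char GC) GX.
rewrite (hV l _ _ GG).
under [RHS]eq_bigr => j _ do rewrite (f_act _ GC GX) scaler_sumr.
rewrite exchange_big; apply: eq_bigr => i _ /=.
rewrite mxE rmorph_sum mulr_suml; apply: eq_bigr => j _ /=.
have aE : act M (map_mx (adjC 'X^q) g) = map_mx (adjC 'X^q) (act M g) := act_nat M C Gg.
by rewrite aE !mxE (rmorphM C) scale_adjC mulrCA mulrA.
Qed.

End IsoInd.

End Induced.

Section Standard.

Variables (k : closedFieldType) (p r : nat).
Hypothesis p_char : p \in [pchar k].

Local Notation q := (p ^ r)%N.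
Local Notation GrTmod := (GrTmod k p r).
Local Notation GrT := (@GrT k p r _).
Let q0 : (0 < q)%N := q_gt0 r p_char.

Fact top_proof : (q.-1 < q)%N. Proof. by rewrite prednK. Qed.
Definition itop : 'I_q := Ordinal top_proof.
Definition ibot : 'I_q := Ordinal q0.

Lemma mul2_natz (l : nat) : 2 * l%:Z = (2 : int) *+ l.
Proof. by rewrite -[RHS]mulr_natr; congr (_ * _); rewrite natz. Qed.

Lemma indfun_hh nu l (A : comAlgType k) (a a' x : A) : x ^+ q = 0 -> a * a' = 1 ->
  indfun p r nu l (\adj (hh a a') *m ul x) = pw a a' (nu + 2 * l%:Z) * x ^+ l.
Proof.
move=> hx e; have e' : a' * a = 1 by rewrite mulrC.
have G : GrT (\adj (hh a a') *m ul x).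
  by apply: GrTM => //; [apply: GrT_adj => //; apply: GrT_hh | apply: GrT_ul].
move: G; rewrite adj_hh mx2M !(mulr1, mul1r, mul0r, mulr0, addr0, add0r) => G.
rewrite (indfunE p_char _ _ G e') (pwN e') pwD // mul2_natz pwMn // -mulrA -exprMn mulrA.
by rewrite -[pw a a' 2]/(a ^+ 2) expr2.
Qed.

Lemma indfun_ul nu l (A : comAlgType k) (s x : A) : s ^+ q = 0 -> x ^+ q = 0 ->
  indfun p r nu l (\adj (ul s) *m ul x) = (x - s) ^+ l.
Proof.
move=> hs hx; have G : GrT (\adj (ul s) *m ul x).
  by apply: GrTM => //; [apply: GrT_adj => //; apply: GrT_ul | apply: GrT_ul].
move: G; rewrite adj_ul ulD addrC => G; rewrite (indfunE p_char _ _ G (mulr1 1)).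
by rewrite /pw; case: (- nu) => n; rewrite expr1n !mul1r.
Qed.

(** The element u^+(s) changes x into x/(1 - sx) and adds a power of 1 - sx; factors congruent to 1
    modulo x do not affect x^(q-1), since x^q = 0. *)
Lemma indfun_uu nu (A : comAlgType k) (s x : A) : s ^+ q = 0 -> x ^+ q = 0 ->
  indfun p r nu q.-1 (\adj (uu s) *m ul x) = x ^+ q.-1.
Proof.
move=> hs hx; have G : GrT (\adj (uu s) *m ul x).
  by apply: GrTM => //; [apply: GrT_adj => //; apply: GrT_uu | apply: GrT_ul].
move: G; rewrite adj_uu mx2M !(mulr1, mul1r, mul0r, mulr0, addr0, add0r) => G.
have xx : x ^+ q.-1 * x = 0 by rewrite -exprSr prednK.
have e : (1 + - s * x) * (1 + - s * x) ^+ q.-1 = 1.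
  by apply: frob_inv => //; apply: frob_unit => //; apply: nilN.
rewrite (indfunE p_char _ _ G e) exprMn; set c := 1 + _ in e *; set c' := c ^+ _ in e *.
have cx : c * x ^+ q.-1 = x ^+ q.-1.
  by rewrite mulrDl mul1r -mulrA [x * _]mulrC xx mulr0 addr0.
have c'x : c' * x ^+ q.-1 = x ^+ q.-1 by rewrite -[in LHS]cx mulrA [c' * c]mulrC e mul1r.
have powx (y : A) n : y * x ^+ q.-1 = x ^+ q.-1 -> y ^+ n * x ^+ q.-1 = x ^+ q.-1.
  by move=> h; elim: n => [|n IH]; rewrite ?mul1r // exprS -mulrA IH.
by rewrite powx // /pw; case: (- nu) => n; rewrite powx.
Qed.

Lemma sum_delta (A : comAlgType k) (l : 'I_q) (c : A) :
  \sum_(m < q) (adjX 'X^q : trunc A q) ^+ m * adjC 'X^q (c *+ (m == l)) =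
  adjX 'X^q ^+ l * adjC 'X^q c.
Proof.
rewrite (bigD1 l) //= eqxx big1 ?addr0 // => m /negPf->.
by rewrite (rmorph0 (adjC _)) mulr0.
Qed.

(** Column l of V is the function y^l, on which U_r^- acts by translating y. *)
Lemma Ind_basis (M : GrTmod) nu : iso_Ind (@BrpT k p r) nu M ->
  exists (V : 'M[k]_(dim M, q)) (W : 'M[k]_(q, dim M)),
  [/\ wbasis (fun l : 'I_q => nu + 2 * l%:Z) V W,
    forall (A : comAlgType k) (s : A) (l : 'I_q), s ^+ q = 0 ->
      act M (ul s) *m extmx A (col l V) =
      extmx A V *m (\col_(m < q) ((- s) ^+ (l - m) *+ 'C(l, m)))
    & vinv true (col itop V)].
Proof.
case=> f [f_Ind f_basis f_act]; have [V [W [VW WV h]]] :=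
  Ind_struct p_char f_Ind f_basis f_act.
have hdelta (A : comAlgType k) (l : 'I_q) (c : A) :
    extmx A V *m (\col_m (c *+ (m == l))) = c *: extmx A (col l V).
  apply/colP => i; rewrite !mxE (bigD1 l) //= !mxE eqxx mulr1n mulrC big1 ?addr0 //.
  by move=> m /negPf ml; rewrite !mxE ml mulr0.
exists V, W; split.
- split=> // l; apply/vwtE => A a a' e; rewrite -hdelta; apply: h; first exact: GrT_hh.
  rewrite (map_hh (adjC _ : {lrmorphism A -> trunc A q})) indfun_hh ?trunc_nil //; last first.
    by rewrite -(rmorphM (adjC _)) e rmorph1.
  by rewrite sum_delta mulrC (map_pw (adjC _)).
- move=> A s l hs; apply: h; first exact: GrT_ul.
  have hS : (adjC _ s : trunc A q) ^+ q = 0 by rewrite -rmorphXn hs rmorph0.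
  rewrite (map_ub false (adjC _ : {lrmorphism A -> trunc A q})) indfun_ul ?trunc_nil //.
  rewrite addrC exprDn.
  rewrite (big_ord_widen q (fun m => (- adjC _ s) ^+ (l - m) * adjX _ ^+ m *+ 'C(l, m) :
    trunc A q)) //.
  rewrite big_mkcond; apply: eq_bigr => m _ /=; rewrite ltnS; case: leqP => [ml|lm].
    by rewrite (rmorphMn (adjC _)) (rmorphXn (adjC _)) (rmorphN (adjC _)) mulrnAr mulrC.
  by rewrite bin_small // mulr0n (rmorph0 (adjC _)) mulr0.
apply/vinvE => A s hs; rewrite -[RHS]scale1r -hdelta; apply: h; first exact: GrT_uu.
have hS : (adjC _ s : trunc A q) ^+ q = 0 by rewrite -rmorphXn hs rmorph0.
rewrite (map_ub true (adjC _ : {lrmorphism A -> trunc A q})) indfun_uu ?trunc_nil //.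
by rewrite sum_delta (rmorph1 (adjC _)) mulr1.
Qed.

Lemma vwt_uniq (M : GrTmod) m n (v : 'cV[k]_(dim M)) : v != 0 -> vwt m v -> vwt n v -> m = n.
Proof.
move=> v0 /vwtE hm /vwtE hn; apply/eqP; apply: contraNT v0 => /(exists_pw_neq k).
move=> [b [b' [e ne]]]; have := hm _ b b' e; rewrite hn // extmx_k => /eqP.
by rewrite -subr_eq0 -scalerBl scaler_eq0 subr_eq0 eq_sym (negPf ne).
Qed.

Lemma coefXN (j i : nat) : (j < q)%N ->
  adjcoef i ((- adjX 'X^q) ^+ j : trunc k^o q) = (-1) ^+ j * (j == i)%:R.
Proof.
move=> jq; rewrite -scaleN1r exprZn scale_adjC adjcoefCM trunc_coefX //.
by congr (_ * _); apply: mulr1.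
Qed.

Section InducedModule.

Variables (M : GrTmod) (nu : int) (V : 'M[k]_(dim M, q)) (W : 'M[k]_(q, dim M)).
Hypothesis hV : wbasis (fun l : 'I_q => nu + 2 * l%:Z) V W.
Hypothesis actV : forall (A : comAlgType k) (s : A) (l : 'I_q), s ^+ q = 0 ->
  act M (ul s) *m extmx A (col l V) =
  extmx A V *m (\col_(m < q) ((- s) ^+ (l - m) *+ 'C(l, m))).

(** The coefficient of s^(q-1) in (y - s)^(q-1) is the constant (-1)^(q-1). *)
Lemma vtop_top : vtop false (col itop V) = (-1) ^+ q.-1 *: col ibot V.
Proof.
rewrite /vtop /tr /nilcoef /conjub /ub /= mulmx1 actV ?trunc_nil // extmx_trunc tc_mulC
  extmx_k.
apply/colP => i; rewrite !mxE (bigD1 ibot) //= !mxE subn0 bin0 mulr1n coefXN ?top_proof //.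
rewrite eqxx mulr1 mulrC big1 ?addr0 // => m m0; rewrite !mxE raddfMn /= coefXN; last first.
  by rewrite (leq_ltn_trans (leq_subr _ _)) ?top_proof.
case: eqP => [e|_]; rewrite ?mulr0 ?mul0rn ?mulr0 //; case/eqP: m0; apply/val_inj => /=.
by move: e (ltn_ord m); clear; lia.
Qed.

(** Translation by s gives y^l the constant term (-s)^l, so an invariant combination involves no y^l
    with l > 0. *)
Lemma vinv_bot (w : 'cV[k]_(dim M)) : vinv false w -> w = (W *m w) ibot 0 *: col ibot V.
Proof.
case: hV => VW WV _ /vinvE/(_ (trunc k^o q) (adjX _) (trunc_nil _ q0)); rewrite /ub => h.
set u := W *m w; have wE : w = V *m u by rewrite mulmxA VW mul1mx.
have uE : W *m w = u by [].
clearbody u.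
have wS : w = \sum_l u l 0 *: col l V.
  apply/colP => i; rewrite [in LHS]wE mxE summxE; apply: eq_bigr => l _.
  by rewrite !mxE mulrC.
have scoef c j (z : trunc k^o q) : adjcoef j (c%:A * z) = c * adjcoef j z.
  by rewrite mulr_algl scale_adjC adjcoefCM; congr (_ * _); apply: mulr1.
have u0 (j : 'I_q) : j != ibot -> u j 0 = 0.
  move=> j0; have := congr1 (fun Z => (extmx (trunc k^o q) W *m Z) ibot 0) h.
  rewrite -extmxM uE {1}wS extmx_sum !mulmx_sumr summxE.
  under eq_bigr => l _.
    rewrite extmxZ -!scalemxAr actV ?trunc_nil // mulmxA -extmxM WV extmx1 mul1mx.
    rewrite !mxE subn0 bin0 mulr1n; over.
  move=> /(congr1 (@adjcoef k k^o 'X^q j)); rewrite raddf_sum (bigD1 j) //= scoef coefXN //.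
  rewrite eqxx mulr1 big1 => [|l lj]; last first.
    by rewrite scoef coefXN ?ltn_ord // -val_eqE /= in lj *; rewrite (negPf lj) !mulr0.
  rewrite addr0 mxE /= -[_%:A]mulr1 scoef -[X in adjcoef _ X](expr0 (adjX 'X^q)) trunc_coefX
    //.
  rewrite eq_sym -[0%N]/(val ibot) val_eqE (negPf j0) mulr0 => /eqP.
  by rewrite mulf_eq0 signr_eq0 orbF => /eqP.
apply/colP => i; rewrite [in LHS]wE !mxE (bigD1 ibot) //= mulrC big1 ?addr0 // => j /u0->.
by rewrite mulr0.
Qed.

Lemma bot_neq0 : col ibot V != 0.
Proof.
case: hV => _ WV _; apply/eqP => e.
have /matrixP/(_ ibot ibot) := WV; rewrite !mxE eqxx mulr1n.
under eq_bigr => j _.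
  have /colP/(_ j) := e; rewrite !mxE => ->; rewrite mulr0; over.
by rewrite big1 // => /eqP; rewrite eq_sym oner_eq0.
Qed.

End InducedModule.

(** The invariants are the constant functions on U_r^-, reached by F^(q-1) from y^(q-1). For
    Delta_r(n), where nu = n - 2(q-1), the vector x has weight n. *)
Lemma Delta_inv (M : GrTmod) nu : iso_Ind (@BrpT k p r) nu M ->
  T_semisimple M /\ exists x : 'cV[k]_(dim M), [/\ vwt (nu + 2 * q.-1%:Z) x, vtop false x != 0
    & forall w, vinv false w -> exists c, w = c *: vtop false x].
Proof.
case/Ind_basis=> V [W [hV actV _]]; split.
  by exists q, (fun l : 'I_q => nu + 2 * l%:Z), V, W.
have s0 : (-1) ^+ q.-1 != 0 :> k by rewrite signr_eq0.
exists (col itop V); rewrite (vtop_top actV); split.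
- by case: hV => _ _ /(_ itop).
- by rewrite scaler_eq0 negb_or s0 (bot_neq0 hV).
move=> w /(vinv_bot hV actV) ->; exists ((W *m w) ibot 0 / (-1) ^+ q.-1).
by rewrite scalerA divfK.
Qed.

(** The value is (-1)^m, by Pascal's rule and the vanishing of C(q, i) in k for 0 < i < q. *)
Lemma bin_neq0 (m : nat) : (m < q)%N -> 'C(q.-1, m)%:R != 0 :> k.
Proof.
have qE : q = q.-1.+1 by rewrite prednK.
have pq (i : nat) : (0 < i < q)%N -> 'C(q, i)%:R = 0 :> k.
  case/andP=> i0 iq.
  have : ('X + 1) ^+ q = 'X^q + 1 ^+ q :> {poly k}.
    by apply: exprDn_pchar; rewrite pnatX (pnatE _ (pcharf_prime p_char)) pchar_poly p_char.
  rewrite expr1n addrC exprDn => /(congr1 (fun f : {poly k} => f`_i)).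
  rewrite coef_sum coefD coefXn coef1 (ltn_eqF iq) (gtn_eqF i0) addr0.
  rewrite (bigD1 (Ordinal (leqW iq))) //= expr1n mul1r coefMn coefXn eqxx big1 ?addr0 //.
  move=> j ji; rewrite expr1n mul1r coefMn coefXn; case: eqP => [e|_]; last exact: mul0rn.
  by case/eqP: ji; apply/val_inj.
suff e : (m < q)%N -> 'C(q.-1, m)%:R = (-1) ^+ m :> k by move=> /e->; rewrite signr_eq0.
elim: m => [|m IH] mq; first by rewrite bin0.
have := pq m.+1; rewrite mq => /(_ isT); rewrite [in 'C(q, _)]qE binS natrD IH ?(ltnW mq) //.
by move/eqP; rewrite addr_eq0 => /eqP->; rewrite exprS mulN1r.
Qed.

End Standard.

(** * Exchange of the Borel subgroups, and the modules nabla_r(n) *)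

Section Twist.

Variables (k : closedFieldType) (p r : nat).
Hypothesis p_char : p \in [pchar k].

Local Notation q := (p ^ r)%N.
Local Notation GrTmod := (GrTmod k p r).
Local Notation GrT := (@GrT k p r _).
Let q0 : (0 < q)%N := q_gt0 r p_char.

(* The automorphism of SL_2 exchanging the two Borel subgroups. *)
Definition sw (A : comAlgType k) (g : 'M[A]_2) : 'M[A]_2 :=
  \matrix_(i, j) g (rev_ord i) (rev_ord j).

Lemma sw_mx2 (A : comAlgType k) (a b c d : A) : sw (mx2 a b c d) = mx2 d c b a.
Proof.
by apply/matrixP => -[[|[|//]] i2] [[|[|//]] j2]; rewrite !mxE.
Qed.

Lemma sw1 (A : comAlgType k) : sw (1%:M : 'M[A]_2) = 1%:M.
Proof. by rewrite -mx2_1 sw_mx2. Qed.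

Lemma swM (A : comAlgType k) (g h : 'M[A]_2) : sw (g *m h) = sw g *m sw h.
Proof.
elim/mx2_ind: g => a b c d; elim/mx2_ind: h => a' b' c' d'.
by rewrite !(sw_mx2, mx2M); congr mx2; ring.
Qed.

Lemma swK (A : comAlgType k) (g : 'M[A]_2) : sw (sw g) = g.
Proof. by elim/mx2_ind: g => a b c d; rewrite !sw_mx2. Qed.

Lemma sw_adj (A : comAlgType k) (g : 'M[A]_2) : sw (\adj g) = \adj (sw g).
Proof. by elim/mx2_ind: g => a b c d; rewrite !(sw_mx2, adj_mx2). Qed.

Lemma sw_map (A B : comAlgType k) (u : {lrmorphism A -> B}) (g : 'M[A]_2) :
  sw (map_mx u g) = map_mx u (sw g).
Proof. by apply/matrixP => i j; rewrite !mxE. Qed.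

Lemma GrT_sw (A : comAlgType k) (g : 'M[A]_2) : GrT g -> GrT (sw g).
Proof.
elim/mx2_ind: g => a b c d; rewrite sw_mx2 !GrT_mx2 // mulrC [c * b]mulrC.
by case/and3P=> -> -> ->.
Qed.

Section Module.

Variable M : GrTmod.

Fact tw_act1 (A : comAlgType k) : act M (sw (1%:M : 'M[A]_2)) = 1%:M.
Proof. by rewrite sw1 act1. Qed.
Fact tw_actM (A : comAlgType k) (g h : 'M[A]_2) : GrT g -> GrT h ->
  act M (sw (g *m h)) = act M (sw g) *m act M (sw h).
Proof. by move=> Gg Gh; rewrite swM actM ?GrT_sw. Qed.
Fact tw_act_nat (A B : comAlgType k) (u : {lrmorphism A -> B}) (g : 'M[A]_2) :
  GrT g -> act M (sw (map_mx u g)) = map_mx u (act M (sw g)).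
Proof. by move=> Gg; rewrite sw_map act_nat ?GrT_sw. Qed.

Definition tw : GrTmod := GrTMod tw_act1 tw_actM tw_act_nat.

End Module.

Lemma BrT_sw (A : comAlgType k) (h : 'M[A]_2) : BrpT p r h -> BrT p r (sw h).
Proof.
rewrite /BrpT /BrT => /andP[/GrT_sw ->]; elim/mx2_ind: h => a b c d.
by rewrite sw_mx2 trig_mx2 trigT_mx2.
Qed.

Lemma BrpT_sw (A : comAlgType k) (h : 'M[A]_2) : BrT p r h -> BrpT p r (sw h).
Proof.
rewrite /BrpT /BrT => /andP[/GrT_sw ->]; elim/mx2_ind: h => a b c d.
by rewrite sw_mx2 trig_mx2 trigT_mx2.
Qed.

Lemma chi_sw n (A : comAlgType k) (h : 'M[A]_2) : BrpT p r h -> chi (- n) h = chi n (sw h).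
Proof.
rewrite /BrpT => /andP[]; elim/mx2_ind: h => a b c d; rewrite trigT_mx2 GrT_mx2 //.
move=> /and3P[/eqP e _ _] /eqP c0; rewrite c0 mulr0 subr0 in e.
by rewrite sw_mx2 !chi_mx2 pwN.
Qed.

Lemma Ind_tw n (M : GrTmod) : iso_Ind (@BrT k p r) n M -> iso_Ind (@BrpT k p r) (- n) (tw M).
Proof.
case=> f [f_Ind f_basis f_act]; exists (fun j A g => f j A (sw g)); split.
- move=> j; have [f_reg f_eq] := f_Ind j; split=> [A B u g Gg|A g h Gg Bh].
    by rewrite sw_map f_reg ?GrT_sw.
  by rewrite chi_sw // swM f_eq ?GrT_sw ?BrT_sw.
- move=> e [e_reg e_eq]; have e_Ind : in_Ind p r (@BrT k p r) n (fun A g => e A (sw g)).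
    split=> [A B u g Gg|A g h Gg Bh]; first by rewrite sw_map e_reg ?GrT_sw.
    by rewrite -[h in chi n h]swK -chi_sw ?BrpT_sw // swM e_eq ?GrT_sw ?BrpT_sw.
  have [c [hc uc]] := f_basis _ e_Ind; exists c; split=> [A x Gx|c' hc'].
    by rewrite -[x in LHS]swK hc ?GrT_sw.
  by apply: uc => A x Gx; rewrite hc' ?GrT_sw // swK.
- by move=> A g x j Gg Gx; rewrite swM sw_adj f_act ?GrT_sw.
Qed.

(** This is [Ind_basis] for the twisted module: the last column is now a lowest weight vector fixed
    by U_r^-, moved by U_r^+ as y^(q-1) was by U_r^-. *)
Lemma nabla_struct n (N : GrTmod) : iso_nabla n N ->
  exists (V : 'M[k]_(dim N, q)) (W : 'M[k]_(q, dim N)),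
  [/\ wbasis (fun l : 'I_q => n - 2 * l%:Z) V W, vinv false (col (itop r p_char) V)
    & forall (A : comAlgType k) (s : A), s ^+ q = 0 ->
      act N (uu s) *m extmx A (col (itop r p_char) V) =
      extmx A V *m (\col_(m < q) ((- s) ^+ (q.-1 - m) *+ 'C(q.-1, m)))].
Proof.
case/Ind_tw/(Ind_basis p_char) => V [W [[VW WV hV] hact hinv]]; exists V, W; split.
- split=> // l; apply/vwtE => A a a' e; have e' : a' * a = 1 by rewrite mulrC.
  have /vwtE/(_ A a' a e') := hV l; rewrite /= sw_mx2 => ->.
  by rewrite -pwN // opprD opprK.
- by apply/vinvE => A x hx; have /vinvE/(_ A x hx) := hinv; rewrite /= sw_mx2.
by move=> A s hs; have := hact A s (itop r p_char) hs; rewrite /= sw_mx2.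
Qed.

Section NablaTrace.

Variables (n : int) (N T : GrTmod) (V : 'M[k]_(dim N, q)) (W : 'M[k]_(q, dim N)).
Hypothesis hV : wbasis (fun l : 'I_q => n - 2 * l%:Z) V W.
Local Notation x := (col (itop r p_char) V).
Hypothesis actx : forall (A : comAlgType k) (s : A), s ^+ q = 0 ->
  act N (uu s) *m extmx A x =
  extmx A V *m (\col_(m < q) ((- s) ^+ (q.-1 - m) *+ 'C(q.-1, m))).

(** The lowest weight vector x generates N under U_r^+: each basis vector occurs in u^+(s) x with
    its own power of s and a nonzero coefficient ([bin_neq0]). *)
Lemma nabla_gen (g : 'M[k]_(dim T, dim N)) : is_hom g -> g *m x = 0 -> g = 0.
Proof.
move=> hg gx0; case: hV => VW _ _.
have : extmx (trunc k^o q) (g *m V) *m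
   (\col_(m < q) ((- adjX 'X^q) ^+ (q.-1 - m) *+ 'C(q.-1, m))) = 0.
  rewrite extmxM -mulmxA -actx ?trunc_nil // mulmxA hg ?GrT_uu ?trunc_nil //.
  by rewrite -mulmxA -extmxM gx0 extmx0 mulmx0.
move=> e; rewrite -[g]mulmx1 -VW mulmxA; suff -> : g *m V = 0 by rewrite mul0mx.
move: (g *m V) e => U e.
apply/matrixP => i l; have /(congr1 (fun Z :
  'cV[trunc k^o q]_(dim T) => @adjcoef k k^o 'X^q (q.-1 - l) (Z i 0))) := e.
have jq (m : 'I_q) : (q.-1 - m < q)%N.
  by rewrite (leq_ltn_trans (leq_subr _ _)) // prednK.
have cE (c : k) (m : 'I_q) : adjcoef (q.-1 - l)
    (c%:A * ((- adjX 'X^q) ^+ (q.-1 - m) *+ 'C(q.-1, m)) : trunc k^o q) =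
    c * ((-1) ^+ (q.-1 - m) * (m == l)%:R *+ 'C(q.-1, m)).
  rewrite mulr_algl scale_adjC adjcoefCM raddfMn /= coefXN //.
  have -> : (q.-1 - m == q.-1 - l)%N = (m == l).
    by rewrite -val_eqE /=; move: (ltn_ord m) (ltn_ord l); clear; lia.
  by congr (_ * _); apply: mulr1.
rewrite mxE [X in _ = adjcoef _ X]mxE raddf0 raddf_sum (bigD1 l) //= big1 => [|m ml].
  rewrite !mxE /= cE eqxx mulr1 addr0 => /eqP.
  rewrite -mulr_natr !mulf_eq0 signr_eq0 (negPf (bin_neq0 p_char (ltn_ord l))) !orbF => /eqP.
  by [].
by rewrite !mxE /= cE (negPf ml) mulr0 mul0rn mulr0.
Qed.

(** Let X send the basis vector of weight n to w and the others to 0. The component of u^+(-y) x at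
    that basis vector is y^(q-1), so u^+(y) X u^+(-y) x = y^(q-1) u^+(y) w, whose coefficient at
    y^(q-1) is w. *)
Lemma nabla_trace (w : 'cV[k]_(dim T)) : vwt n w ->
  exists2 X : 'M[k]_(dim T, dim N), wt_hom 0 X & tr true X *m x = w.
Proof.
move=> hw; case: (hV) => VW WV _; pose i0 := ibot r p_char; pose X := w *m row i0 W.
exists X.
  pose Z : 'M[k]_(dim T, q) := w *m delta_mx 0 i0.
  have -> : X = Z *m W by rewrite /X /Z -mulmxA -rowE.
  apply: (wts_hom hV) => j; rewrite add0r.
  have -> : col j Z = (j == i0)%:R *: w.
    by apply/colP => i; rewrite !mxE big_ord1 !mxE eqxx mulrC.
  have [->|_] := eqVneq j i0; first by rewrite scale1r mulr0 subr0.
  rewrite scale0r; apply/vwtE => A a a' e.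
  by rewrite extmx0 mulmx0 scaler0.
pose Z (A : comAlgType k) (y : A) : 'cV[A]_(dim T) := act T (uu y) *m extmx A w.
have Zn : nilnat q Z.
  by move=> A B u y hy; rewrite /Z (act_ub_nat p_char true T u hy) map_mxM map_extmx.
have Z0 : nilcoef q Z 0 = w.
  have := nil_expand q0 Zn (nil0 r p_char k^o); rewrite /Z uu0 act1 mul1mx !extmx_k => e.
  rewrite [RHS]e (bigD1 i0) // big1 => [|i ii].
    by rewrite [RHS]addr0 [_ ^+ _]expr0 scale1r extmx_k.
  by rewrite expr0n; move: ii; rewrite -val_eqE /= => /negbTE->; rewrite scale0r.
have y0 : (adjX 'X^q : trunc k^o q) ^+ q = 0 by apply: trunc_nil.
have XV : X *m V = w *m row i0 1%:M by rewrite /X -mulmxA -row_mul WV.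
have E : conjub true X (adjX 'X^q : trunc k^o q) *m extmx _ x =
    adjX 'X^q ^+ q.-1 *: Z _ (adjX 'X^q : trunc k^o q).
  rewrite /conjub /ub -!mulmxA actx ?nilN // [extmx _ X *m _]mulmxA -extmxM XV extmxM.
  rewrite -[extmx _ w *m _ *m _]mulmxA /Z scalemxAr; congr (_ *m _).
  rewrite -mul_mx_scalar; congr (_ *m _); apply/matrixP => i j; rewrite !ord1 !mxE mulr1n.
  rewrite (bigD1 i0) //= !mxE eqxx subn0 bin0 opprK /= scale1r mul1r big1 ?addr0 // => m mi.
  by rewrite !mxE eq_sym (negPf mi) /= scale0r mul0r.
have -> : tr true X *m x = tc q.-1 (conjub true X (adjX 'X^q : trunc k^o q) *m extmx _ x).
  by rewrite extmx_trunc tc_mulCr extmx_k.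
rewrite E (nil_expand q0 Zn y0) scaler_sumr tc_sum (bigD1 i0) //= big1 => [|i ii].
  rewrite extmx_trunc scalerA -exprD tc_ZC addn0 trunc_coefX ?prednK // eqxx scale1r addr0.
  by rewrite extmx_k.
have -> : adjX 'X^q ^+ q.-1 *: (adjX 'X^q ^+ i *:
  extmx _ (nilcoef q Z i)) = 0 :> 'cV[trunc k^o q]_(dim T).
  rewrite scalerA -exprD; have -> : (q.-1 + i = q + i.-1)%N.
    have : (0 < i)%N by rewrite lt0n; apply: contra ii => /eqP e; apply/eqP/val_inj.
    by move: q0; clear; lia.
  by rewrite exprD y0 mul0r scale0r.
by rewrite /tc map_mx0.
Qed.

End NablaTrace.

End Twist.

(** * Filtered modules *)

Section Filtrations.

Variables (k : closedFieldType) (p r : nat).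
Hypothesis p_char : p \in [pchar k].

Local Notation q := (p ^ r)%N.
Local Notation GrTmod := (GrTmod k p r).
Local Notation GrT := (@GrT k p r _).
Let q0 : (0 < q)%N := q_gt0 r p_char.

Lemma trZ b (M N : GrTmod) c (X : 'M[k]_(dim N, dim M)) : tr b (c *: X) = c *: tr b X.
Proof.
rewrite -!mul_scalar_mx; apply: (trM_l p_char (L := M) (M := N) (N := N)) => A x hx.
by rewrite /commutes /extmx map_scalar_mx scalar_mxC.
Qed.

Lemma vtop_inv (M : GrTmod) (v : 'cV[k]_(dim M)) : vinv false (vtop false v).
Proof. exact: (tr_ub_hom p_char (M := triv k p r)). Qed.

Lemma vtop_wt (M : GrTmod) n (v : 'cV[k]_(dim M)) : vwt (n + 2 * q.-1%:Z) v ->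
  vwt n (vtop false v).
Proof. by move=> h; have := tr_wt p_char false h; rewrite /sgw addrK. Qed.

Lemma vtop_hom (M N : GrTmod) (f : 'M[k]_(dim N, dim M)) (v : 'cV[k]_(dim M)) :
  is_hom f -> vtop false (f *m v) = f *m vtop false v.
Proof.
by move=> hf; apply: (trM_l p_char (L := triv k p r)); apply: hom_ub.
Qed.

Lemma hom_vinv b (M N : GrTmod) (f : 'M[k]_(dim N, dim M)) (v : 'cV[k]_(dim M)) :
  is_hom f -> vinv b v -> vinv b (f *m v).
Proof. by move=> hf hv; apply: ub_homM => //; apply: hom_ub. Qed.

Lemma hom_vwt n (M N : GrTmod) (f : 'M[k]_(dim N, dim M)) (v : 'cV[k]_(dim M)) :
  is_hom f -> vwt n v -> vwt n (f *m v).
Proof. by move=> hf hv; rewrite -[n]add0r; apply: wt_homM => //; apply: hom_wt. Qed.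

Lemma sub_vinv b (M N : GrTmod) (f : 'M[k]_(dim N, dim M)) L (v : 'cV[k]_(dim M)) :
  is_hom f -> L *m f = 1%:M -> vinv b (f *m v) -> vinv b v.
Proof.
move=> hf Lf /vinvE h; apply/vinvE => A x hx; have := h A x hx.
rewrite extmxM mulmxA -hf ?GrT_ub // -mulmxA => /(congr1 (mulmx (extmx A L))).
by rewrite !mulmxA -extmxM Lf extmx1 !mul1mx.
Qed.

Lemma sub_vwt n (M N : GrTmod) (f : 'M[k]_(dim N, dim M)) L (v : 'cV[k]_(dim M)) :
  is_hom f -> L *m f = 1%:M -> vwt n (f *m v) -> vwt n v.
Proof.
move=> hf Lf /vwtE h; apply/vwtE => A a a' e; have := h A a a' e.
rewrite extmxM mulmxA -hf ?GrT_hh // -mulmxA => /(congr1 (mulmx (extmx A L))).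
by rewrite -scalemxAr !mulmxA -extmxM Lf extmx1 !mul1mx.
Qed.

Lemma Tr_homr (L M N : GrTmod) (X : 'M[k]_(dim N, dim M)) (Z : 'M[k]_(dim M, dim L)) :
  is_hom Z -> Tr (M := L) (N := N) (X *m Z) = Tr X *m Z.
Proof.
move=> hZ; rewrite /Tr (trM_r p_char _ (hom_ub p_char true hZ)).
exact: (trM_r p_char _ (hom_ub p_char false hZ)).
Qed.

Lemma TrD (M N : GrTmod) (X Y : 'M[k]_(dim N, dim M)) : Tr (X + Y) = Tr X + Tr Y.
Proof. by rewrite /Tr !trD. Qed.

(* Freeness over U_r^-, seen on the invariants. *)
Definition invtop (M : GrTmod) := forall mu (w : 'cV[k]_(dim M)),
  vinv false w -> vwt mu w -> exists2 w', vwt (mu + 2 * q.-1%:Z) w' & w = vtop false w'.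

(** Bounds the dimension of the space of U_r^- -invariants of weight nu from below by c. *)
Definition inv_family (M : GrTmod) nu c (W : 'M[k]_(dim M, c)) :=
  [/\ forall u : 'cV_c, vinv false (W *m u), forall u : 'cV_c, vwt nu (W *m u)
    & forall u : 'cV_c, W *m u = 0 -> u = 0].

(** The top factor Delta_r(n) has a vector x'' of weight n whose F^(q-1)-image spans its invariants.
    A weight vector x lifting x'' gives the invariant F^(q-1) x of M; modulo its multiples all
    invariants of weight n - 2(q-1) come from M', and it adds one member to the family for n. *)
Lemma Delta_filtered s (M : GrTmod) : filtered (@iso_Delta k p r) s M ->
  [/\ T_semisimple M, invtop M & forall n, exists W : 'M[k]_(dim M, count_mem n s),
     inv_family (n - 2 * q.-1%:Z) W].
Proof.
elim=> {s M} [M M0|n s M' M M'' i f ses _ [ss' it' cnt'] CM''].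
  have v0 m (v : 'M[k]_(dim M, m)) : v = 0 by apply/matrixP => -[j hj]; exfalso;
    rewrite M0 in hj.
  split.
  - exists (dim M), (fun=> 0), 1%:M, 1%:M; split; rewrite ?mulmx1 // => -[j hj].
    by exfalso; rewrite M0 in hj.
  - move=> mu w hw _; exists 0; last by rewrite [LHS]v0 [RHS]v0.
    by apply/vwtE => A a a' e; rewrite extmx0 mulmx0 scaler0.
  move=> m; exists 0; split=> u; rewrite ?mul0mx; last by move=> _; apply/matrixP => -[].
    by apply/vinvE => A x hx; rewrite extmx0 mulmx0.
  by apply/vwtE => A a a' e; rewrite extmx0 mulmx0 scaler0.
have qE : (q%:Z - 1 = q.-1%:Z) by rewrite -[in LHS](prednK q0) -addn1 PoszD addrK.
rewrite /iso_Delta qE in CM''.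
have [ss'' [x'' [wx'' x''0 hx'']]] := Delta_inv p_char CM''; rewrite subrK in wx''.
have [S [L [fS Li fi iLS]]] := ses_split ses; case: (ses) => hi hf _ _ _.
have [x [wx fx]] := weight_lift p_char ses ss' wx''.
have ker (z : 'cV[k]_(dim M)) : f *m z = 0 -> z = i *m (L *m z).
  by move=> fz; rewrite -[LHS]mul1mx -iLS mulmxDl -[S *m f *m z]mulmxA fz mulmx0 addr0 mulmxA.
split; first exact: ses_semisimple ses ss' ss''.
- have base (mu : int) (w : 'cV[k]_(dim M)) : vinv false w -> vwt mu w -> f *m w = 0 ->
      exists2 w', vwt (mu + 2 * q.-1%:Z) w' & w = vtop false w'.
    move=> iw ww /ker wE; rewrite wE in iw ww.
    have [u wu uE] := it' mu _ (sub_vinv hi Li iw) (sub_vwt hi Li ww).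
    by exists (i *m u); [apply: hom_vwt | rewrite vtop_hom // -uE].
  move=> mu w iw ww; have [c cE] := hx'' _ (hom_vinv hf iw).
  have [fw0|fw0] := eqVneq (f *m w) 0; first exact: base.
  (* A nonzero image in the top factor forces the weight, so the correction by a multiple of x is
     homogeneous. *)
  have ew : mu = n - 2 * q.-1%:Z.
    apply: (vwt_uniq fw0 (hom_vwt hf ww)); rewrite cE; apply: wt_homZ.
    by apply: vtop_wt; rewrite subrK.
  have wcx : vwt (mu + 2 * q.-1%:Z) (c *: x) by rewrite ew subrK; apply: wt_homZ.
  have [|||w' ww' w'E] := base mu (w - vtop false (c *: x)).
  - apply/vinvE => A y hy; rewrite extmxB mulmxBr.
    by move/vinvE: iw => ->//; move/vinvE: (vtop_inv (c *: x)) => ->.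
  - apply/vwtE => A a a' e; rewrite extmxB mulmxBr scalerBr.
    by move/vwtE: ww => ->//; move/vwtE: (vtop_wt wcx) => ->.
  - by rewrite mulmxBr cE -vtop_hom // -scalemxAr fx /vtop trZ subrr.
  exists (w' + c *: x); first exact: wt_homD.
  by rewrite /vtop trD -/(vtop _ w') -w'E subrK.
move=> m; have [W [W1 W2 W3]] := cnt' m.
have [W1' W2'] : (forall u : 'cV_(count_mem m s), vinv false (i *m W *m u)) /\
    (forall u : 'cV_(count_mem m s), vwt (m - 2 * q.-1%:Z) (i *m W *m u)).
  by split=> u; rewrite -mulmxA; [apply: hom_vinv | apply: hom_vwt].
have W3' (u : 'cV_(count_mem m s)) : i *m W *m u = 0 -> u = 0.
  by move=> e; apply: W3; have := congr1 (mulmx L) e; rewrite mulmx0 !mulmxA Li mul1mx.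
rewrite /=; have [nm|nm] := eqVneq n m; last by exists (i *m W).
have uE (u : 'cV[k]_(1 + count_mem m s)) :
    row_mx (vtop false x) (i *m W) *m u =
    usubmx u 0 0 *: vtop false x + i *m W *m dsubmx u.
  rewrite -[u in LHS]vsubmxK mul_row_col; congr (_ + _).
  by rewrite -mul_mx_scalar; congr (_ *m _); apply/matrixP => a b;
    rewrite !ord1 [RHS]mxE mulr1n.
exists (row_mx (vtop false x) (i *m W)); split=> u; rewrite uE.
- apply/vinvE => A y hy; rewrite extmxD mulmxDr extmxZ -scalemxAr.
  by move/vinvE: (vtop_inv x) => ->//; move/vinvE: (W1' (dsubmx u)) => ->.
- apply: wt_homD; last exact: W2'.
  by apply: wt_homZ; rewrite -nm; apply: vtop_wt; rewrite subrK.
move=> e; have /eqP := congr1 (mulmx f) e.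
rewrite mulmxDr -scalemxAr -vtop_hom // fx !mulmxA fi !mul0mx addr0 mulmx0.
rewrite scaler_eq0 (negPf x''0) orbF => /eqP u0.
rewrite u0 scale0r add0r in e; rewrite -[u]vsubmxK (W3' _ e).
apply/colP => j; rewrite mxE; case: splitP => j' _; last by rewrite !mxE.
by rewrite ord1 u0 mxE.
Qed.

(** On nabla_r(n) with invariant generator x, the vector g x is invariant, hence F^(q-1) w' for some
    w' of weight n. By [nabla_trace], w' is the value at x of an integral over U_r^+ of a
    T-equivariant th; so Tr th and g agree on x, hence everywhere by [nabla_gen]. T-equivariant
    splittings carry this through extensions. *)
Lemma trace_surj s (X T : GrTmod) : invtop T -> filtered (@iso_nabla k p r) s X ->
  forall g : 'M[k]_(dim T, dim X), is_hom g ->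
    exists2 th : 'M[k]_(dim T, dim X), wt_hom 0 th & g = Tr th.
Proof.
move=> iT; suff: filtered (@iso_nabla k p r) s X -> T_semisimple X /\ forall g : 'M[k]_(dim T,
  dim X), is_hom g ->
    exists2 th : 'M[k]_(dim T, dim X), wt_hom 0 th & g = Tr th.
  by move=> h /h[].
elim=> {s X} [M M0|n s M' M M'' i f ses _ [ss' IH] CM''].
  split.
    exists (dim M), (fun=> 0), 1%:M, 1%:M; split; rewrite ?mulmx1 // => -[j hj].
    by exfalso; rewrite M0 in hj.
  move=> g _; exists 0; last by apply/matrixP => a [b hb]; exfalso; rewrite M0 in hb.
  by move=> A a a' e; rewrite extmx0 mulmx0 mul0mx scaler0.
have [V [W [hV inx hact]]] := nabla_struct p_char CM''.
have ss'' : T_semisimple M'' by exists q, (fun l : 'I_q => n - 2 * l%:Z), V, W.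
split; first exact: ses_semisimple ses ss' ss''.
have base (h : 'M[k]_(dim T, dim M'')) : is_hom h -> exists2 th, wt_hom 0 th & h = Tr (M :=
  M'') th.
  move=> hh; set x := col _ V in inx hact.
  have wx : vwt (n - 2 * q.-1%:Z) x by case: hV => _ _ /(_ (itop r p_char)).
  have [w' ww' w'E] := iT _ _ (hom_vinv hh inx) (hom_vwt hh wx); rewrite subrK in ww'.
  have [th th0 thx] := nabla_trace hV hact ww'; exists th => //.
  apply/eqP; rewrite -subr_eq0; apply/eqP; apply: (nabla_gen hV hact).
    by apply: is_homB => //; apply: Tr_hom.
  by rewrite mulmxBl w'E /Tr -(trM_r p_char (L := triv k p r)) // thx subrr.
move=> g hg; case: (ses) => hi hf _ _ _.
have [S [L [fS Li iLS wS wL]]] := ses_section p_char ses ss' ss''.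
have fi : f *m i = 0 by have [? [? []]] := ses_split ses.
have [th' w' e'] := IH _ (is_homM hg hi).
have wth1 : wt_hom 0 (th' *m L) by rewrite -[0]addr0; apply: wt_homM.
(* The difference vanishes on M' and so factors through M'', where the basic case applies. *)
pose h := g - Tr (M := M) (th' *m L).
have hh : is_hom h by apply: is_homB => //; apply: Tr_hom.
have hi0 : h *m i = 0.
  by rewrite mulmxBl -(Tr_homr _ hi) -mulmxA Li mulmx1 -e' subrr.
have hE : h = h *m S *m f.
  by rewrite -[LHS]mulmx1 -iLS mulmxDr !mulmxA hi0 mul0mx add0r.
have hhS : is_hom (M := M'') (h *m S).
  move=> A x Gx; rewrite -[LHS]mulmx1 -[RHS]mulmx1 -(extmx1 A) -fS (extmxM A f S) !mulmxA.
  congr (_ *m extmx A S); rewrite -[LHS]mulmxA -hf // mulmxA -extmxM -hE hh //.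
  by rewrite -mulmxA -extmxM -hE.
have [th'' w'' e''] := base _ hhS.
exists (th' *m L + th'' *m f).
  by apply: wt_homD => //; rewrite -[0]addr0; apply: wt_homM => //; apply: hom_wt.
have e2 : h = Tr (M := M) (th'' *m f) by rewrite (Tr_homr _ hf) -e''.
by rewrite TrD -e2 /h addrC subrK.
Qed.

End Filtrations.

(** * Indecomposable modules *)

Section Local.

Variables (k : closedFieldType) (p r : nat).
Hypothesis p_char : p \in [pchar k].

Local Notation q := (p ^ r)%N.
Local Notation GrTmod := (GrTmod k p r).
Local Notation GrT := (@GrT k p r _).

(** Fitting's lemma: P projects onto the part where X is invertible, along the part where X is
    nilpotent. It is a polynomial in X, hence inherits all commutations, over every A. *)
Lemma fitting_idem n (X : 'M[k]_n) : exists P : 'M[k]_n,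
  [/\ P *m P = P,
      forall (A : comAlgType k) (Z : 'M[A]_n), comm_mx (extmx A X) Z -> comm_mx (extmx A P) Z,
      P = 1%:M -> X \in unitmx & P = 0 -> X - 1%:M \in unitmx].
Proof.
case: n X => [|n] X.
  exists 1%:M; split; rewrite ?mulmx1 // ?unitmxE ?det_mx00 ?unitr1 //.
  by move=> A Z _; rewrite extmx1; apply: comm_mx_sym; apply: comm_mx1.
have [m [g groot gE]] := multiplicity_XsubC (char_poly X) 0.
have char0 : char_poly X != 0 by rewrite monic_neq0 // char_poly_monic.
rewrite char0 /= -coprimep_XsubC in groot; rewrite subr0 in groot gE.
(* The exponent m + 1 makes f divisible by X even for m = 0, so that P = 1 exhibits an inverse of
   X. *)
have : coprimep g ('X^(m.+1)) by apply: coprimep_expr.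
case/Bezout_eq1_coprimepP => -[v u] /= e.
pose hm : {rmorphism {poly k} -> 'M[k]_n.+1} := horner_mx X.
have hz : hm (g * 'X^(m.+1)) = 0.
  by rewrite exprSr mulrA -gE (rmorphM hm) /hm /= Cayley_Hamilton mul0r.
pose f := u * 'X^(m.+1).
have f1 : v * g = 1 - f by rewrite -e addrK.
exists (hm f); split.
- have : hm (f * (1 - f)) = 0.
    have -> : f * (1 - f) = u * v * (g * 'X^(m.+1)).
      by rewrite -f1 /f mulrACA ['X^_ * g]mulrC.
    by rewrite (rmorphM hm) hz mulr0.
  rewrite mulrBr mulr1 (rmorphB hm) => /eqP; rewrite subr_eq0 => /eqP;
    rewrite (rmorphM hm f f).
  by move/esym.
- move=> A Z h; rewrite /hm /extmx map_horner_mx.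
  by apply: comm_mx_sym; apply: comm_mx_horner; apply: comm_mx_sym.
- move=> h1; have : hm (u * 'X^m) *m X = 1%:M.
    by rewrite -h1 /f exprSr mulrA [RHS](rmorphM hm) /hm /= horner_mx_X.
  by case/mulmx1_unit.
move=> h0; have vg1 : hm (v * g) = 1 by rewrite f1 (rmorphB hm) h0 subr0 rmorph1.
have Xm : X ^+ m.+1 = 0.
  rewrite -[LHS]mul1r -vg1 -[X in _ * X ^+ _]horner_mx_X -(rmorphXn hm) -(rmorphM hm) -mulrA.
  by rewrite (rmorphM hm) hz mulr0.
have := subrX1 X m.+1; rewrite Xm sub0r => /(congr1 -%R); rewrite opprK -mulrN.
by move/esym/mulmx1_unit => [].
Qed.

Section Summand.

Variables (M : GrTmod) (P : 'M[k]_(dim M)) (d : nat).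
Variables (C : 'M[k]_(dim M, d)) (R : 'M[k]_(d, dim M)).
Hypotheses (P_hom : is_hom P) (CR : C *m R = P) (RC : R *m C = 1%:M).

(** The image of the idempotent P as a module, in the coordinates of a rank factorisation P = C
    R. *)
Definition sub_act (A : comAlgType k) (g : 'M[A]_2) : 'M[A]_d :=
  extmx A R *m act M g *m extmx A C.

Fact sub_act1 (A : comAlgType k) : sub_act (1%:M : 'M[A]_2) = 1%:M.
Proof. by rewrite /sub_act act1 mulmx1 -extmxM RC extmx1. Qed.

Lemma sub_actC (A : comAlgType k) (g : 'M[A]_2) : GrT g ->
  extmx A C *m sub_act g = act M g *m extmx A C.
Proof.
move=> Gg; rewrite /sub_act !mulmxA -extmxM CR P_hom // -mulmxA -extmxM.
by rewrite -CR -mulmxA RC mulmx1.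
Qed.

Lemma sub_actR (A : comAlgType k) (g : 'M[A]_2) : GrT g ->
  extmx A R *m act M g = sub_act g *m extmx A R.
Proof.
move=> Gg; rewrite /sub_act -[RHS]mulmxA -extmxM CR -[RHS]mulmxA -P_hom // mulmxA.
by rewrite -extmxM -CR mulmxA RC mul1mx.
Qed.

Fact sub_actM (A : comAlgType k) (g h : 'M[A]_2) : GrT g -> GrT h ->
  sub_act (g *m h) = sub_act g *m sub_act h.
Proof.
move=> Gg Gh; rewrite [sub_act (g *m h)]/sub_act actM // mulmxA sub_actR //.
by rewrite /sub_act !mulmxA.
Qed.

Fact sub_act_nat (A B : comAlgType k) (u : {lrmorphism A -> B}) (g : 'M[A]_2) :
  GrT g -> sub_act (map_mx u g) = map_mx u (sub_act g).
Proof. by move=> Gg; rewrite /sub_act act_nat // !map_mxM !map_extmx. Qed.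

Definition summand : GrTmod := GrTMod sub_act1 sub_actM sub_act_nat.

End Summand.

Lemma idem_split n (P : 'M[k]_n) : P *m P = P ->
  exists d (C : 'M[k]_(n, d)) (R : 'M[k]_(d, n)), [/\ C *m R = P, R *m C = 1%:M & d = \rank P].
Proof.
move=> PP; have CR : col_base P *m row_base P = P := mulmx_base P.
have e : col_base P *m (row_base P *m col_base P *m row_base P) = col_base P *m row_base P.
  by rewrite -(mulmxA (row_base P)) CR mulmxA CR.
exists (\rank P), (col_base P), (row_base P); split=> //.
apply: (row_free_inj (row_base_free P)); apply: (row_full_inj (col_base_full P)).
by rewrite /= mul1mx.
Qed.

Lemma indecomposable_idem (M : GrTmod) (P : 'M[k]_(dim M)) : indecomposable M ->
  is_hom P -> P *m P = P -> P = 0 \/ P = 1%:M.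
Proof.
case=> _ ind hP PP; pose Q := 1%:M - P.
have id_hom : is_hom (M := M) (N := M) (1%:M : 'M[k]_(dim M)).
  by move=> A g Gg; rewrite extmx1 mulmx1 mul1mx.
have hQ : is_hom Q by apply: is_homB.
have QQ : Q *m Q = Q by rewrite /Q mulmxBr mulmx1 mulmxBl mul1mx PP subrr subr0.
have [d [C [R [CR RC dE]]]] := idem_split PP.
have [d' [C' [R' [CR' RC' dE']]]] := idem_split QQ.
have PQ : P *m Q = 0 by rewrite /Q mulmxBr mulmx1 PP subrr.
have QP : Q *m P = 0 by rewrite /Q mulmxBl mul1mx PP subrr.
have RC0 : R *m C' = 0.
  have e : R = R *m P by rewrite -CR mulmxA RC mul1mx.
  have e' : C' = Q *m C' by rewrite -CR' -mulmxA RC' mulmx1.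
  by rewrite e e' mulmxA -[R *m P *m Q]mulmxA PQ mulmx0 mul0mx.
have RC0' : R' *m C = 0.
  have e : R' = R' *m Q by rewrite -CR' mulmxA RC' mul1mx.
  have e' : C = P *m C by rewrite -CR -mulmxA RC mulmx1.
  by rewrite e e' mulmxA -[R' *m Q *m P]mulmxA QP mulmx0 mul0mx.
have [] := ind (summand hP CR RC) (summand hQ CR' RC').
- exists (col_mx R R'), (row_mx C C'); split.
  + move=> A g Gg; rewrite /extmx map_col_mx -!/(extmx _ _) mul_col_mx /= /dsum_act
    mul_block_col.
    by rewrite !mul0mx addr0 add0r (sub_actR hP CR RC Gg) (sub_actR hQ CR' RC' Gg).
  + move=> A g Gg; rewrite /extmx map_row_mx -!/(extmx _ _) mul_mx_row /= /dsum_act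
    mul_row_block.
    by rewrite !mulmx0 addr0 add0r (sub_actC hP CR RC Gg) (sub_actC hQ CR' RC' Gg).
  + by rewrite mul_row_col CR CR' /Q addrC subrK.
  + by rewrite mul_col_row RC RC' RC0 RC0' -scalar_mx_block.
- by move=> /= /eqP; rewrite dE mxrank_eq0 => /eqP; left.
by move=> /= /eqP; rewrite dE' mxrank_eq0 subr_eq0 => /eqP <-; right.
Qed.

(** The Fitting idempotent of X is an endomorphism of M, hence 0 or 1. *)
Lemma End_local (M : GrTmod) (X : 'M[k]_(dim M)) : indecomposable M -> is_hom X ->
  X \in unitmx \/ X - 1%:M \in unitmx.
Proof.
move=> ind hX; have [P [PP comm h1 h0]] := fitting_idem X.
have hP : is_hom P by move=> A g Gg; apply: comm; apply: hX.
by case: (indecomposable_idem ind hP PP) => [/h0|/h1]; [right | left].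
Qed.

Lemma hom_inv (M : GrTmod) (X : 'M[k]_(dim M)) : X \in unitmx -> is_hom X -> is_hom (invmx X).
Proof.
move=> uX hX A g Gg.
rewrite -[LHS]mulmx1 -(extmx1 A) -(mulmxV uX) extmxM mulmxA.
rewrite -[_ *m act M g *m _]mulmxA -hX // mulmxA -extmxM mulVmx // extmx1 mul1mx //.
Qed.

Lemma sum_unit (M : GrTmod) I (s : seq I) (F : I -> 'M[k]_(dim M)) : indecomposable M ->
  (forall i, is_hom (F i)) -> \sum_(i <- s) F i \in unitmx -> exists i, F i \in unitmx.
Proof.
move=> ind hF; elim: s => [|a s IH].
  rewrite big_nil; case: ind => d0 _ /mulmxV; rewrite mul0mx => /matrixP.
  by move=> /(_ (Ordinal d0) (Ordinal d0)); rewrite !mxE eqxx => /eqP; rewrite eq_sym oner_eq0.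
rewrite big_cons; set S := \sum_(_ <- _) _ in IH *; set U := _ + S => uU.
have hS : is_hom S.
  move=> A g Gg; rewrite /S extmx_sum mulmx_suml mulmx_sumr.
  by apply: eq_bigr => i _; apply: hF.
have hU : is_hom U by move=> A g Gg; rewrite extmxD mulmxDl mulmxDr hF // hS.
(* With U = F a + S invertible, U^-1 F a and U^-1 S add up to 1, so one of them is a unit. *)
have [u1|u2] := End_local ind (is_homM (hom_inv uU hU) (hF a)).
  by exists a; move: u1; rewrite unitmx_mul => /andP[].
apply: IH; have : - (invmx U *m S) \in unitmx.
  rewrite (_ : - _ = invmx U *m F a - 1%:M) // -(mulVmx uU) -mulmxBr -mulmxN.
  by rewrite /U opprD addrA subrr add0r.
by rewrite -mulmxN unitmx_mul => /andP[_]; rewrite -scaleN1r unitmxZ ?unitrN1.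
Qed.

End Local.

(** * Averages of maps of rank one, and the theorem *)

Section Line.

Variables (k : closedFieldType) (p r : nat).
Hypothesis p_char : p \in [pchar k].

Local Notation q := (p ^ r)%N.
Local Notation GrTmod := (GrTmod k p r).
Let q0 : (0 < q)%N := q_gt0 r p_char.

Variables (T : GrTmod) (lam nu : int) (xi : 'rV[k]_(dim T)).
Hypothesis wxi : forall (A : comAlgType k) (a a' : A), a * a' = 1 ->
  extmx A xi *m act T (hh a a') = pw a a' lam *: extmx A xi.

Definition matcoef (w : 'cV[k]_(dim T)) (A : comAlgType k) (y : A) : 'M[A]_1 :=
  extmx A xi *m act T (uu y) *m extmx A w.

Lemma tc_alg a b i c (Y : 'M[trunc k^o q]_(a, b)) : tc i (c%:A *: Y) = c *: tc i Y.
Proof.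
apply/matrixP => m n; rewrite !mxE mulr_algl scale_adjC adjcoefCM.
by congr (_ * _); apply: mulr1.
Qed.

Lemma matcoef_nat w : nilnat q (matcoef w).
Proof.
move=> A B u y hy; rewrite /matcoef (act_ub_nat p_char true T u hy).
by rewrite !map_mxM !map_extmx.
Qed.

(** Moving t in T across u^+(y) gives t^lam c(y) = t^nu c(t^2 y) for the matrix coefficient c;
    coefficients of y^i are compared at a k-point separating lam from nu + 2i. *)
Lemma matcoef_weight w i : vwt nu w -> (i < q)%N -> nilcoef q (matcoef w) i != 0 ->
  lam = nu + 2 * i%:Z.
Proof.
move=> /vwtE hw iq ci; apply/eqP; apply: contraNT ci => /(exists_pw_neq k)[b [b' [e ne]]].
set B := trunc k^o q; pose u : {lrmorphism k^o -> B} := @scalars k B.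
pose X : B := adjX _.
have hX : X ^+ q = 0 by apply: trunc_nil.
have eu : u b * u b' = 1 by rewrite -rmorphM e rmorph1.
have uE n : pw (u b) (u b') n = (pw b b' n)%:A := esym (map_pw u b b' n).
have hX2 := nilM (pw (u b) (u b') 2) hX.
have tcA c (Y : 'M[B]_1) : tc i (c%:A *: Y) = c *: tc i Y by apply: tc_alg.
have c1 : tc i (matcoef w X) = nilcoef q (matcoef w) i by [].
have cX j : (j < q)%N -> adjcoef i (X ^+ j) = (j == i)%:R by apply: trunc_coefX.
clearbody X; move: (u b) (u b') eu uE hX2 => t t' et uE hX2.
have E : pw t t' lam *: matcoef w X = pw t t' nu *: matcoef w (pw t t' 2 * X).
  have wxit := wxi et; have hwt := hw _ _ _ et; have := hh_ub true X et;
    rewrite /ub /sgw => hu.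
  rewrite /matcoef !scalemxAl -wxit -[_ *m act T (hh _ _) *m _]mulmxA.
  rewrite -(actM T (GrT_hh r p_char et) (GrT_uu p_char hX)) hu.
  rewrite (actM T (GrT_uu p_char hX2) (GrT_hh r p_char et)) -!mulmxA hwt.
  by rewrite -!scalemxAr -!scalemxAl.
have c2 : tc i (matcoef w (pw t t' 2 * X)) = pw b b' (2 * i%:Z) *: nilcoef q (matcoef w) i.
  rewrite (nil_expand q0 (matcoef_nat w) hX2) tc_sum.
  have tE (j : 'I_q) : tc i ((pw t t' 2 * X) ^+ j *: extmx B (nilcoef q (matcoef w) j)) =
      (j == i :> nat)%:R *: (pw b b' (2 * j%:Z) *: nilcoef q (matcoef w) j).
    rewrite exprMn -(pwMn et) -mul2_natz uE -scalerA tcA extmx_trunc tc_ZC (cX _ (ltn_ord j)).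
    by rewrite extmx_k !scalerA mulrC.
  transitivity (\sum_(j < q) (j == i :> nat)%:R *: (pw b b' (2 * j%:Z) *:
    nilcoef q (matcoef w) j)).
    by apply: eq_bigr => j _; apply: tE.
  clear -iq; rewrite (bigD1 (Ordinal iq)) //= big1 => [|j].
    by rewrite eqxx scale1r addr0.
  by rewrite -val_eqE /= => /negbTE->; rewrite scale0r.
move: (matcoef w X) (matcoef w (_ * X)) E c1 c2 => Y1 Y2; rewrite !uE => E c1 c2.
have := congr1 (tc i) E; rewrite !tcA c1 c2 scalerA -(pwD e) => /eqP.
by rewrite -subr_eq0 -scalerBl scaler_eq0 subr_eq0 (negPf ne).
Qed.

(* The weight of xi fixes the only coefficient of u^+ which contributes. *)
Lemma tr_line (z : 'cV[k]_(dim T)) : exists z1 : 'cV[k]_(dim T),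
  forall w, vwt nu w -> exists c, tr (M := T) (N := T) true (z *m xi) *m w = c *: z1.
Proof.
pose B := trunc k^o q; pose X : B := adjX _.
have hX : X ^+ q = 0 by apply: trunc_nil.
have trE w : tr (M := T) (N := T) true (z *m xi) *m w =
    tc q.-1 (act T (uu X) *m extmx B z *m matcoef w (- X)).
  have -> : tr (M := T) (N := T) true (z *m xi) *m w =
      tc q.-1 (conjub true (M := T) (N := T) (z *m xi) X *m extmx B w).
    by rewrite extmx_trunc tc_mulCr extmx_k.
  by rewrite /conjub extmxM /matcoef !mulmxA.
have matE w : matcoef w (- X) =
    \sum_(i < q) (- X) ^+ i *: extmx B (nilcoef q (matcoef w) i).
  exact: (nil_expand q0 (matcoef_nat w) (nilN p_char hX)).
clearbody X; have [[i0 /eqP lamE]|no] := altP (@existsP _ (fun i :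
  'I_q => lam == nu + 2 * i%:Z)).
  (* Only the term (-x)^i0 of xi u^+(-x) w survives, so w enters through one scalar. *)
  exists (tc q.-1 (X ^+ i0 *: (act T (uu X) *m extmx B z))) => w hw.
  exists ((-1) ^+ i0 * nilcoef q (matcoef w) i0 0 0).
  have c0 (j : 'I_q) : j != i0 -> nilcoef q (matcoef w) j = 0.
    move=> ji; apply/eqP; apply: contraNT ji => /(matcoef_weight hw (ltn_ord j)).
    by rewrite lamE => e; apply/eqP/val_inj => /=; lia.
  rewrite trE matE; move: (nilcoef q (matcoef w)) c0 => f c0.
  move: (act T (uu X) *m extmx B z) => Y.
  rewrite (bigD1 i0) //= big1 => [|j /c0 ->]; last by rewrite extmx0 scaler0.
  rewrite addr0; have -> : extmx B (f i0) = ((f i0 0 0)%:A)%:M.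
    by apply/matrixP => a b; rewrite !ord1 !mxE mulr1n.
  rewrite scale_scalar_mx mul_mx_scalar -scaleN1r exprZn mulr_algr scalerA.
  have sc (c : k) (t : B) (Z : 'cV[B]_(dim T)) : (c *: t) *: Z = c%:A *: (t *: Z).
    by rewrite scalerA mulr_algl.
  by rewrite sc tc_alg [f i0 0 0 * _]mulrC.
exists 0 => w hw; exists 0; rewrite trE scale0r matE.
have c0 (j : 'I_q) : nilcoef q (matcoef w) j = 0.
  apply/eqP; apply: contraNT no => /(matcoef_weight hw (ltn_ord j)) e.
  by apply/existsP; exists j; apply/eqP.
move: (nilcoef q (matcoef w)) c0 => f c0.
move: (act T (uu X) *m extmx B z) => Y.
rewrite big1 => [|j _]; last by rewrite c0 extmx0 scaler0.
by rewrite mulmx0 /tc map_mx0.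
Qed.

End Line.

Theorem proposition6p3 (k : closedFieldType) (p : nat)
    (p_char : p \in [pchar k]) (p_gt2 : (2 < p)%N)
    (r : nat) (r_gt0 : (0 < r)%N) (m n : int)
    (T : GrTmod k p r) (T_m : is_Tr m T)
    (c : nat) (T_n_c : Delta_mult T n c) :
  c = 0%N \/ c = 1%N.
Proof.
case: T_m => [[_ [s1 fN]] ind _]; case: T_n_c => s fDs ->.
have [[d [lam [V [W hV]]]] it /(_ n)[F]] := Delta_filtered p_char fDs.
have [VW WV hVw] := hV.
set nu := n - _ => -[Finv Fwt Finj].
have id_hom : is_hom (M := T) (N := T) (1%:M : 'M[k]_(dim T)).
  by move=> A g Gg; rewrite extmx1 mulmx1 mul1mx.
have [th th0 thE] := trace_surj p_char it fN id_hom.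
(* The weights of the j-th basis vector and of the j-th dual covector cancel, so each summand of th
   is T-equivariant. *)
pose G j := Tr (M := T) (N := T) (th *m col j V *m row j W).
have wW j (A : comAlgType k) (a a' : A) : a * a' = 1 ->
    extmx A (row j W) *m act T (hh a a') = pw a a' (lam j) *: extmx A (row j W).
  move=> e; rewrite /extmx map_row -/(extmx A W) -row_mul (wbasis_dual hV) //.
  by apply/rowP => i; rewrite mxE mul_diag_mx !mxE.
have hG j : is_hom (G j).
  apply: (Tr_hom p_char) => A a a' e; rewrite scale1r !extmxM !mulmxA th0 // scale1r.
  have /vwtE := hVw j; move=> /(_ A a a' e) eV.
  rewrite -[_ *m act T _ *m extmx A (col j V)]mulmxA eV -[RHS]mulmxA wW //.
  by rewrite -!scalemxAr -scalemxAl.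
have sG : \sum_j G j = 1%:M.
  have VWs : V *m W = \sum_j col j V *m row j W.
    apply/matrixP => a b; rewrite mxE summxE; apply: eq_bigr => j _.
    by rewrite !mxE big_ord1 !mxE.
  rewrite thE -[th in RHS]mulmx1 -VW VWs mulmx_sumr /Tr !tr_sum.
  apply: eq_bigr => j _; rewrite /G -(mulmxA th); apply: erefl.
have [j uj] : exists j, G j \in unitmx.
  by apply: (sum_unit ind hG (s := index_enum 'I_d)); rewrite sG unitmx1.
have [z1 hz1] := tr_line p_char nu (wW j) (th *m col j V).
(* On a U_r^- -invariant w the outer integral acts as F^(q-1) on the inner one applied to w, and
   [tr_line] makes the latter a multiple of z1. *)
have line w : vinv false w -> vwt nu w -> exists e, w = e *: (invmx (G j) *m vtop false z1).
  move=> iw ww; have [e eE] := hz1 w ww; exists e.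
  rewrite scalemxAr -[LHS](mulKmx uj); congr (_ *m _).
  rewrite /G /Tr -(trM_r p_char (L := triv k p r)) // eE.
  exact: (trZ p_char false (M := triv k p r) e z1).
case: (count_mem n s) F Finv Fwt Finj => [|[|c']] F Finv Fwt Finj;
  [by left | by right | exfalso].
(* Two members of the family lie on one line, against the injectivity of F. *)
pose d0 : 'cV[k]_c'.+2 := delta_mx ord0 0.
pose d1 : 'cV[k]_c'.+2 := delta_mx (lift ord0 ord0) 0.
have [e0 E0] := line _ (Finv d0) (Fwt d0); have [e1 E1] := line _ (Finv d1) (Fwt d1).
have /Finj/colP h : F *m (e1 *: d0 - e0 *: d1) = 0.
  by rewrite mulmxBr -!scalemxAr E0 E1 !scalerA mulrC subrr.
have e10 : e1 = 0 by have := h ord0; rewrite !mxE /= mulr1 mulr0 subr0.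
have /Finj/colP/(_ (lift ord0 ord0)) : F *m d1 = 0 by rewrite E1 e10 scale0r.
by rewrite !mxE eqxx => /eqP; rewrite oner_eq0.
Qed.
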